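(* Let $G_{\bar 0}$ be a closed subgroup of $GL_m(\mathbb{C})\times GL_n(\mathbb{C})$ for some $m,n$. Let $\mathfrak{g}=\mathfrak{g}_{\bar 0}\oplus\mathfrak{g}_{\bar 1}$ be a Lie sub-superalgebra of $\mathfrak{gl}(m|n)$ with $\operatorname{Lie}G_{\bar 0}=\mathfrak{g}_{\bar 0}$ and such that $\mathfrak{g}_{\bar 1}$ is stable under the adjoint (conjugation) action of $G_{\bar 0}$. Suppose there exists a supersubspace $M\subseteq\mathfrak{gl}(m|n)$ such that $\mathfrak{gl}(m|n)=M\oplus\mathfrak{g}$ and $[\mathfrak{g},M]\subseteq M$. Then the intersection with $\mathfrak{g}$ of each $GL_m(\mathbb{C})\times GL_n(\mathbb{C})$-orbit in $\mathfrak{gl}(m|n)$ is a union of finitely many $G_{\bar 0}$-orbits.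
   Context: $\mathfrak{gl}(m|n)$ is the general linear Lie superalgebra of $(m+n)\times(m+n)$ complex matrices, with even part the block diagonal matrices $\mathfrak{gl}_m\oplus\mathfrak{gl}_n$, odd part the block off-diagonal matrices, and $[\cdot,\cdot]$ the supercommutator. The group $GL_m(\mathbb{C})\times GL_n(\mathbb{C})$ (block diagonal invertible matrices) acts on $\mathfrak{gl}(m|n)$ by conjugation, and $\operatorname{Lie}G_{\bar 0}$ is viewed inside $\mathfrak{gl}_m\oplus\mathfrak{gl}_n=\mathfrak{gl}(m|n)_{\bar 0}$. A supersubspace is a $\mathbb{Z}/2$-graded subspace $M=M_{\bar 0}\oplus M_{\bar 1}$ with $M_{\bar i}\subseteq\mathfrak{gl}(m|n)_{\bar i}$. *)

(* Defs.v *)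
From HB Require Import structures.
From mathcomp Require Import all_boot all_order all_algebra.
From mathcomp Require Import classical_sets reals.
From mathcomp Require Import complex mpoly.

Set Implicit Arguments.
Unset Strict Implicit.
Unset Printing Implicit Defensive.

Import GRing.Theory.
Local Open Scope ring_scope.
Local Open Scope classical_set_scope.

Section GeneralLinearSuperalgebra.
Variables (K : fieldType) (m n : nat).
Local Notation gl := 'M[K]_(m + n).

(* Homogeneous component of degree b, with b = false even and b = true odd. *)
Definition hpart (b : bool) (A : gl) : gl :=
  if b then block_mx 0 (ursubmx A) (dlsubmx A) 0
  else block_mx (ulsubmx A) 0 0 (drsubmx A).

Fact hpart_is_linear b : linear (hpart b).
Proof.
move=> a A B; rewrite /hpart.
case: b; rewrite scale_block_mx add_block_mx !scaler0 !addr0.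
  by congr block_mx; apply/matrixP=> i j; rewrite !mxE.
by congr block_mx; apply/matrixP=> i j; rewrite !mxE.
Qed.

HB.instance Definition _ b :=
  GRing.isLinear.Build K gl gl *:%R (hpart b) (hpart_is_linear b).

Definition glpart (b : bool) : {vspace gl} := limg (linfun (hpart b)).

Lemma mem_glpart b A : (A \in glpart b) = (hpart b A == A).
Proof.
apply/memv_imgP/eqP => [[B _ ->]|<-]; last by exists A; rewrite ?memvf ?lfunE.
rewrite lfunE /= /hpart; case: b.
  by rewrite block_mxKur block_mxKdl.
by rewrite block_mxKul block_mxKdr.
Qed.

(* The supercommutator: [A, B] = A B - (-1)^(a b) B A on homogeneous elements
   of degrees a and b, extended bilinearly. *)
Definition sbracket (A B : gl) : gl :=
  \sum_(a : bool) \sum_(b : bool)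
    (hpart a A *m hpart b B - (-1) ^+ (a && b) *: (hpart b B *m hpart a A)).

Definition is_supersubspace (V : {vspace gl}) : Prop :=
  (V = V :&: glpart false + V :&: glpart true)%VS.

Definition is_lie_subsuperalgebra (V : {vspace gl}) : Prop :=
  is_supersubspace V /\
  forall A B, A \in V -> B \in V -> sbracket A B \in V.

Definition GLxGL : set gl :=
  [set h | h \in glpart false /\ h \in unitmx].

Definition conj_orbit (G : set gl) (A : gl) : set gl :=
  [set h *m A *m invmx h | h in G].

(* Polynomial functions on matrices: one variable per entry, the entries being
   enumerated by mxvec. *)
Local Notation mxpol := {mpoly K[(m + n) * (m + n)]}.

Definition mxeval (p : mxpol) (A : gl) : K := p.@[fun k => mxvec A 0 k].

Definition mxdiff (p : mxpol) (A X : gl) : K :=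
  \sum_k mxvec X 0 k * (p^`M(k)).@[fun k => mxvec A 0 k].

Definition is_subgroup (G : set gl) : Prop :=
  [/\ G `<=` GLxGL, G 1%:M,
      forall g h, G g -> G h -> G (g *m h)
    & forall h, G h -> G (invmx h)].

(* "Closed" is meant for the Zariski topology. Polynomials in the entries
   suffice: clearing powers of the determinant in a regular function on the
   group does not change its zero locus. *)
Definition zariski_closed (G : set gl) : Prop :=
  exists S : set mxpol,
    G = [set h | GLxGL h /\ forall p, S p -> mxeval p h = 0].

Definition is_closed_subgroup (G : set gl) : Prop :=
  is_subgroup G /\ zariski_closed G.

Definition vanishing_ideal (G : set gl) : set mxpol :=
  [set p | forall h, G h -> mxeval p h = 0].

(* Lie algebra of a linear algebraic group as its tangent space at 1. *)
Definition lie_of_group (G : set gl) : set gl :=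
  [set X | forall p, vanishing_ideal G p -> mxdiff p 1%:M X = 0].

End GeneralLinearSuperalgebra.

Arguments glpart {K m n} b.
Arguments GLxGL {K m n}.

(* Main.v *)
Require Import Defs.
From mathcomp Require Import all_boot all_order all_algebra.
From mathcomp Require Import classical_sets reals complex.
From mathcomp Require Import boolp mpoly closed_field ring.

(* This is Richardson's tangent space argument. Let O be the orbit of A and
   W = O `&` g. For x in W, the tangent space of O at x is [gl_0, x], and the
   complement M forces [gl_0, x] `&` g = [g_0, x]; so the tangent space of W at
   x is already spanned by the vector fields generated by G0.

   Instead of comparing dimensions, one shows that a polynomial p vanishing on
   G0.x vanishes on W near x: modulo the ideal I of W, p lies in every power of
   the maximal ideal m of x (apply to p an Euler vector field at x, which is
   modulo I + m^2 a combination of the fields of G0), and Krull's intersection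
   theorem concludes. Hence the closures of G0.x and G0.y coincide for y in W
   near x. By quantifier elimination an orbit contains a nonempty open subset
   of its closure, so orbits with the same closure are equal: each orbit is
   open in W, and W is quasi-compact. *)

Set Implicit Arguments.
Unset Strict Implicit.
Unset Printing Implicit Defensive.
Import GRing.Theory.
Local Open Scope ring_scope.

(** * Ideals and Hilbert's basis theorem *)

Section Ideals.
Variable A : comNzRingType.
Implicit Types (I : set A) (s : seq A).

Definition is_ideal I : Prop :=
  [/\ I 0, forall a b, I a -> I b -> I (a + b) & forall c a, I a -> I (c * a)].

(** The ideal generated by [s], encoded as the intersection of all ideals containing [s]: a
    membership is exploited by instantiating it at a well-chosen ideal, and no linear combination is
    ever written out. *)
Definition gen s : set A :=
  fun a => forall I, is_ideal I -> (forall b, b \in s -> I b) -> I a.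

(** Phrased for arbitrary subsets, so that the finite generating family is drawn from [S] itself.
    This form gives quasi-compactness directly. *)
Definition noetherian : Prop :=
  forall S : set A, exists s,
    (forall a, a \in s -> S a) /\ (forall a, S a -> gen s a).

Lemma ideal0 I : is_ideal I -> I 0. Proof. by case. Qed.

Lemma idealD I a b : is_ideal I -> I a -> I b -> I (a + b).
Proof. by case=> _ + _; apply. Qed.

Lemma idealM I c a : is_ideal I -> I a -> I (c * a).
Proof. by case=> _ _; apply. Qed.

Lemma ideal_mulr I c a : is_ideal I -> I a -> I (a * c).
Proof. by rewrite mulrC; apply: idealM. Qed.

Lemma idealN I a : is_ideal I -> I a -> I (- a).
Proof. by rewrite -mulN1r; apply: idealM. Qed.

Lemma idealB I a b : is_ideal I -> I a -> I b -> I (a - b).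
Proof. by move=> iI Ia Ib; apply: idealD => //; apply: idealN. Qed.

Lemma ideal_sum I (T : Type) (r : seq T) (P : pred T) (F : T -> A) :
  is_ideal I -> (forall i, P i -> I (F i)) -> I (\sum_(i <- r | P i) F i).
Proof.
move=> iI IF; elim/big_ind: _ => //; first exact: ideal0.
by move=> a b; apply: idealD.
Qed.
Global Arguments ideal_sum {I T r P F}.

Lemma gen_ideal s : is_ideal (gen s).
Proof.
split=> [I iI _|a b Ia Ib I iI sI|c a Ia I iI sI]; first exact: ideal0.
  by apply: idealD => //; [apply: Ia|apply: Ib].
by apply: idealM => //; apply: Ia.
Qed.

Lemma mem_gen s a : a \in s -> gen s a.
Proof. by move=> sa I _; apply. Qed.

Lemma sub_gen s t a : {subset s <= t} -> gen s a -> gen t a.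
Proof. by move=> st sa; apply: sa (gen_ideal t) _ => b /st; apply: mem_gen. Qed.

(** Each of the finitely many generators of the ideal spanned by [S] involves only finitely many
    elements of [S]; collecting these gives the family. *)
Lemma noetherian_ideals :
  (forall I, is_ideal I -> exists s,
     (forall a, a \in s -> I a) /\ (forall a, I a -> gen s a)) -> noetherian.
Proof.
move=> idfg S.
pose I : set A := fun a => exists2 s, forall b, b \in s -> S b & gen s a.
have iI : is_ideal I.
  split=> [|a b [s sS sa] [t tS tb]|c a [s sS sa]].
  - by exists [::] => //; apply: ideal0 (gen_ideal _).
  - exists (s ++ t) => [c|]; first by rewrite mem_cat => /orP[/sS|/tS].
    apply: idealD (gen_ideal _) _ _.
      by apply: sub_gen sa => c; rewrite mem_cat => ->.
    by apply: sub_gen tb => c; rewrite mem_cat orbC => ->.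
  - by exists s => //; apply: idealM (gen_ideal _) _.
have [t [tI It]] := idfg I iI.
have [s sS ts] : exists2 s, forall b, b \in s -> S b & forall b, b \in t -> gen s b.
  elim: t tI {It} => [|b t IHt] tI; first by exists [::].
  have [c ct|s sS ts] := IHt; first by apply: tI; rewrite inE ct orbT.
  have [s' s'S s'b] := tI b (mem_head _ _).
  exists (s' ++ s) => [c|c]; first by rewrite mem_cat => /orP[/s'S|/sS].
  rewrite inE => /predU1P[->|/ts sc].
    by apply: sub_gen s'b => d; rewrite mem_cat => ->.
  by apply: sub_gen sc => d; rewrite mem_cat orbC => ->.
exists s; split=> // a Sa.
suff /It ta : I a by apply: ta (gen_ideal s) ts.
exists [:: a]; last by apply: mem_gen; rewrite mem_head.
by move=> b; rewrite inE => /eqP ->.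
Qed.

End Ideals.

Lemma noetherian_surj (A B : comNzRingType) (f : {rmorphism A -> B}) :
  (forall b, exists a, f a = b) -> noetherian A -> noetherian B.
Proof.
move=> fsurj nA S; have [s [sS Ss]] := nA (fun a => S (f a)).
exists (map f s); split=> [_ /mapP[a /sS Sa ->] //|b].
have [a <- /Ss sa] := fsurj b; move=> J [J0 JD JM] sJ.
apply: (sa (fun a => J (f a))) => [|c sc]; last by apply/sJ/map_f.
split=> [|c d Jc Jd|c d Jd]; rewrite ?rmorph0 ?rmorphD ?rmorphM //.
  exact: JD.
exact: JM.
Qed.

Lemma field_noetherian (K : fieldType) : noetherian K.
Proof.
apply: noetherian_ideals => I iI.
have [[a Ia a0]|no] := pselect (exists2 a, I a & a != 0).
  exists [:: a]; split=> [b|b _]; first by rewrite inE => /eqP ->.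
  rewrite -(mulfVK a0 b); apply: idealM (gen_ideal _) _.
  by apply: mem_gen; rewrite mem_head.
exists [::]; split=> // a Ia; have [->|a0] := eqVneq a 0.
  exact: ideal0 (gen_ideal _).
by case: no; exists a.
Qed.

Section HilbertBasis.
Variables (A : comNzRingType) (nA : noetherian A).
Variables (I : set {poly A}) (iI : is_ideal I).
Implicit Types (p q r : {poly A}) (s : seq {poly A}).

Lemma gen_sub_ideal s p : (forall q, q \in s -> I q) -> gen s p -> I p.
Proof. by move=> sI; apply. Qed.

(** Induction on the degree: finitely many members of [I] of degree at most [d] suffice to cancel
    the coefficient of degree [d] of any other, and the difference falls under the induction
    hypothesis. *)
Lemma hilbert_low d : exists2 s, forall p, p \in s -> I p &
  forall p, I p -> (size p <= d)%N -> gen s p.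
Proof.
elim: d => [|d [s sI IHs]].
  exists [::] => // p _; rewrite size_poly_leq0 => /eqP ->.
  exact: ideal0 (gen_ideal _).
pose P a p := [/\ I p, (size p <= d.+1)%N & p`_d = a].
have [l [lP Pl]] := nA (fun a => exists p, P a p).
have [t tP lt] : exists2 t, forall p, p \in t -> I p & forall a, a \in l ->
    exists2 p, gen t p & (size p <= d.+1)%N /\ p`_d = a.
  elim: l lP {Pl} => [|a l IHl] lP; first by exists [::].
  have [b bl|t tP lt] := IHl; first by apply: lP; rewrite inE bl orbT.
  have [p [Ip szp pa]] := lP a (mem_head _ _).
  exists (p :: t) => [q|b]; first by rewrite inE => /predU1P[->|/tP].
  rewrite inE => /predU1P[->|/lt[q tq qb]].
    by exists p => //; apply: mem_gen; rewrite mem_head.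
  by exists q => //; apply: sub_gen tq => c; rewrite inE orbC => ->.
exists (t ++ s) => [p|p Ip szp]; first by rewrite mem_cat => /orP[/tP|/sI].
have [q tq [szq qp]] : exists2 q, gen t q & (size q <= d.+1)%N /\ q`_d = p`_d.
  have : gen l p`_d by apply: Pl; exists p.
  move=> /(_ (fun a => exists2 q, gen t q & (size q <= d.+1)%N /\ q`_d = a)).
  apply=> //; split=> [|a b [q tq [szq <-]] [r tr [szr <-]]|c a [q tq [szq <-]]].
  - by exists 0; [apply: ideal0 (gen_ideal _)|rewrite size_poly0 coef0].
  - exists (q + r); first exact: idealD (gen_ideal _) _ _.
    by rewrite coefD (leq_trans (size_polyD _ _)) // geq_max szq.
  - exists (c%:P * q); first exact: idealM (gen_ideal _) _.
    by rewrite coefCM mul_polyC (leq_trans (size_scale_leq _ _)).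
rewrite -(subrK q p); apply: idealD (gen_ideal _) _ _.
  have : gen s (p - q).
    apply: IHs; first by apply: idealB iI Ip _; apply: gen_sub_ideal tq.
    apply/leq_sizeP => j; rewrite leq_eqVlt => /predU1P[<-|ltdj].
      by rewrite coefB qp subrr.
    by rewrite coefB !nth_default ?subrr // (leq_trans _ ltdj).
  by apply: sub_gen => c; rewrite mem_cat orbC => ->.
by apply: sub_gen tq => c; rewrite mem_cat => ->.
Qed.

(** Leading coefficients are taken in all degrees at once. Finitely many generate the others, [d]
    bounds the degrees of their lifts, and powers of ['X] raise these lifts to any degree [k] beyond
    [d]. *)
Lemma hilbert_high : exists d, exists2 s, forall p, p \in s -> I p &
  forall p k, I p -> (d <= k)%N -> (size p <= k.+1)%N ->
    exists2 q, gen s q & (size q <= k.+1)%N /\ q`_k = p`_k.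
Proof.
pose P a p k := [/\ I p, (size p <= k.+1)%N & p`_k = a].
have [l [lP Pl]] := nA (fun a => exists p k, P a p k).
have [d [t tI lt]] : exists d, exists2 t, forall p, p \in t -> I p &
    forall a, a \in l -> forall k, (d <= k)%N ->
    exists2 p, gen t p & (size p <= k.+1)%N /\ p`_k = a.
  elim: l lP {Pl} => [|a l IHl] lP; first by exists 0%N, [::].
  have [b bl|d [t tI lt]] := IHl; first by apply: lP; rewrite inE bl orbT.
  have [p [e [Ip szp pa]]] := lP a (mem_head _ _).
  exists (maxn d e), (p :: t) => [q|b]; first by rewrite inE => /predU1P[->|/tI].
  rewrite inE => /predU1P[-> k|/lt lb k]; rewrite geq_max => /andP[dk ek].
    exists ('X^(k - e) * p).
      by apply: idealM (gen_ideal _) _; apply: mem_gen; rewrite mem_head.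
    rewrite coefXnM ltnNge leq_subr /= subKn // pa; split=> //.
    rewrite mulrC; apply: leq_trans (size_polyMleq _ _) _; rewrite size_polyXn addnS /=.
    by rewrite (leq_trans (leq_add szp (leqnn _))) // addSn subnKC.
  have [q tq qb] := lb k dk; exists q => //.
  by apply: sub_gen tq => c; rewrite inE orbC => ->.
exists d, t => // p k Ip dk szp.
have : gen l p`_k by apply: Pl; exists p, k.
move=> /(_ (fun a => exists2 q, gen t q & (size q <= k.+1)%N /\ q`_k = a)).
apply=> [|a al]; last exact: lt.
split=> [|a b [q tq [szq <-]] [r tr [szr <-]]|c a [q tq [szq <-]]].
- by exists 0; [apply: ideal0 (gen_ideal _)|rewrite size_poly0 coef0].
- exists (q + r); first exact: idealD (gen_ideal _) _ _.
  by rewrite coefD (leq_trans (size_polyD _ _)) // geq_max szq.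
- exists (c%:P * q); first exact: idealM (gen_ideal _) _.
  by rewrite coefCM mul_polyC (leq_trans (size_scale_leq _ _)).
Qed.

End HilbertBasis.

Theorem hilbert_basis (A : comNzRingType) : noetherian A -> noetherian {poly A}.
Proof.
move=> nA; apply: noetherian_ideals => I iI.
have [d [t tI ht]] := hilbert_high nA I.
have [s sI hs] := hilbert_low nA iI d.
exists (t ++ s); split=> [p|p Ip]; first by rewrite mem_cat => /orP[/tI|/sI].
have [k] := ubnP (size p); elim: k p Ip => // k IHk p Ip; rewrite ltnS => szp.
have [kd|dk] := leqP k d.
  have : gen s p by apply: hs => //; apply: leq_trans kd.
  by apply: sub_gen => c; rewrite mem_cat orbC => ->.
case: k => // k in IHk szp dk *.
have [q tq [szq qp]] := ht p k Ip dk szp.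
rewrite -(subrK q p); apply: idealD (gen_ideal _) _ _; last first.
  by apply: sub_gen tq => c; rewrite mem_cat => ->.
have Ipq : I (p - q) by apply: (idealB iI Ip); exact: tq.
have szpq : (size (p - q)%R < k.+1)%N; last exact: (IHk _ Ipq szpq).
rewrite ltnS; apply/leq_sizeP => j; rewrite leq_eqVlt => /predU1P[<-|ltkj].
  by rewrite coefB qp subrr.
by rewrite coefB !nth_default ?subrr // (leq_trans _ ltkj).
Qed.

Theorem mpoly_noetherian (K : fieldType) n : noetherian {mpoly K[n]}.
Proof.
elim: n => [|n IHn].
  apply: (@noetherian_surj _ _ (@mpolyC 0 K) _ (@field_noetherian K)) => p.
  exists p@_0%MM; apply/mpolyP=> m; rewrite mcoeffC.
  by have -> : m = 0%MM; [apply/mnmP; case|rewrite eqxx mulr1].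
(* Polynomials in one variable over [{mpoly K[n]}] map onto [{mpoly K[n.+1]}] by sending ['X] to the
   last variable; surjectivity is enough to transfer noetherianity. *)
have cfu : commr_rmorph (@mwiden n K) 'X_ord_max by move=> p; exact: mulrC.
pose f : {rmorphism {poly {mpoly K[n]}} -> {mpoly K[n.+1]}} := horner_morph cfu.
apply: (@noetherian_surj _ _ f _ (hilbert_basis IHn)).
elim/mpolyind => [|c m p _ _ [q <-]]; first by exists 0; rewrite rmorph0.
have [r rm] : exists r, f r = 'X_[m].
  rewrite mpolyXE_id; elim/big_ind: _ => [|_ _ [a <-] [b <-]|i _].
  - by exists 1; rewrite rmorph1.
  - by exists (a * b); rewrite rmorphM.
  have [lti|gei] := ltnP i n.
    have -> : i = widen_ord (leqnSn n) (Ordinal lti) by apply/val_inj.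
    exists (('X_(Ordinal lti) : {mpoly K[n]})%:P ^+
      m (widen_ord (leqnSn n) (Ordinal lti))).
    by rewrite rmorphXn /f /= horner_morphC /= mwidenX mnmwiden1.
  have -> : i = ord_max.
    by apply/val_inj/eqP; rewrite eqn_leq gei -ltnS ltn_ord.
  by exists ('X ^+ m ord_max); rewrite rmorphXn /f /= horner_morphX.
exists (c%:MP%:P * r + q); rewrite rmorphD rmorphM rm /f /= horner_morphC /= mwidenC.
by rewrite mul_mpolyC.
Qed.

(** * Powers of the maximal ideal of a point *)

Section IdealSum.
Variable A : comNzRingType.
Implicit Types I J : set A.

Definition ideal_sum_set I J : set A := fun a => exists2 b, I b & J (a - b).

Lemma ideal_sum_ideal I J :
  is_ideal I -> is_ideal J -> is_ideal (ideal_sum_set I J).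
Proof.
move=> iI iJ; split=> [|a b [a' Ia Ja] [b' Ib Jb]|c a [a' Ia Ja]].
- by exists 0; rewrite ?subr0; apply: ideal0.
- exists (a' + b'); first exact: (idealD iI).
  by rewrite opprD addrACA; apply: (idealD iJ).
- exists (c * a'); first exact: (idealM _ iI).
  by rewrite -mulrBr; apply: (idealM _ iJ).
Qed.

Lemma ideal_sum_l I J a : is_ideal J -> I a -> ideal_sum_set I J a.
Proof. by move=> iJ Ia; exists a; rewrite ?subrr //; apply: ideal0. Qed.

Lemma ideal_sum_r I J a : is_ideal I -> J a -> ideal_sum_set I J a.
Proof. by move=> iI Ja; exists 0; rewrite ?subr0 //; apply: ideal0. Qed.

(** The increasing chain of colon ideals of [I] by powers of [t] stabilises: take an exponent that
    works for finitely many generators of its union. *)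
Lemma noetherian_colon I t : noetherian A -> is_ideal I ->
  exists n, forall b k, I (b * t ^+ k) -> I (b * t ^+ n).
Proof.
move=> nA iI; have [s [sS Ss]] := nA (fun b => exists k, I (b * t ^+ k)).
have [n nP] : exists n, forall b, b \in s -> I (b * t ^+ n).
  elim: s sS {Ss} => [|b s IHs] sS; first by exists 0%N.
  have [c cs|n nP] := IHs; first by apply: sS; rewrite inE cs orbT.
  have [k bk] := sS b (mem_head _ _); exists (n + k)%N => c.
  rewrite inE exprD => /predU1P[->|/nP cn].
    by rewrite mulrCA; apply: idealM.
  by rewrite mulrA; exact: (ideal_mulr _ iI).
exists n => b k bk; have /Ss : exists k, I (b * t ^+ k) by exists k.
move=> /(_ (fun b => I (b * t ^+ n))); apply=> //.
split=> [|c d|c d]; first by rewrite mul0r; apply: ideal0.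
  by rewrite mulrDl; apply: idealD.
by rewrite -mulrA; apply: idealM.
Qed.

End IdealSum.

(** * Polynomial vector fields as derivations *)

Section VectorFields.
Variables (K : comNzRingType) (N : nat).
Local Notation mxp := {mpoly K[N]}.
Implicit Types (a : 'I_N -> mxp) (p q : mxp).

Definition vfield a p : mxp := \sum_i a i * p^`M(i).

Lemma vfieldD a p q : vfield a (p + q) = vfield a p + vfield a q.
Proof.
rewrite /vfield -big_split.
by apply: eq_bigr => i _; rewrite mderivD mulrDr.
Qed.

Lemma vfieldB a p q : vfield a (p - q) = vfield a p - vfield a q.
Proof.
by rewrite /vfield -sumrB; apply: eq_bigr => i _; rewrite mderivB mulrBr.
Qed.

Lemma vfieldM a p q : vfield a (p * q) = vfield a p * q + p * vfield a q.
Proof.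
rewrite /vfield mulr_suml mulr_sumr -big_split; apply: eq_bigr => i _.
by rewrite /= mderivM; ring.
Qed.

Lemma vfield0 a : vfield a 0 = 0.
Proof. by rewrite /vfield big1 // => i _; rewrite mderiv0 mulr0. Qed.

Lemma vfield_sum a (T : Type) (r : seq T) (P : pred T) F :
  vfield a (\sum_(i <- r | P i) F i) = \sum_(i <- r | P i) vfield a (F i).
Proof. exact: (big_morph _ (vfieldD a) (vfield0 a)). Qed.

Lemma vfieldC a c : vfield a c%:MP = 0.
Proof. by rewrite /vfield big1 // => i _; rewrite mderivC mulr0. Qed.

Lemma vfieldX a i : vfield a 'X_i = a i.
Proof.
rewrite /vfield (bigD1 i) //= big1 => [|j ji].
  rewrite mderivX mnm1E eqxx scale1r; have -> : (U_(i) - U_(i) = 0)%MM.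
    by apply/mnmP => j; rewrite mnmBE subnn mnm0E.
  by rewrite mpolyX0 mulr1 addr0.
by rewrite mderivX mnm1E eq_sym (negPf ji) scale0r mulr0.
Qed.

End VectorFields.

Section PointIdeal.
Variables (K : fieldType) (N : nat) (x : 'I_N -> K).
Local Notation mxp := {mpoly K[N]}.
Implicit Types (a : 'I_N -> mxp) (p q : mxp).

Definition tvar i : mxp := 'X_i - (x i)%:MP.

Lemma meval_tvar i : (tvar i).@[x] = 0.
Proof. by rewrite mevalB mevalXU mevalC subrr. Qed.

Lemma vfield_tvar a i : vfield a (tvar i) = a i.
Proof. by rewrite vfieldB vfieldX vfieldC subr0. Qed.

(* The k-th power of the maximal ideal of the point x. *)
Fixpoint mpow k : set mxp := fun p =>
  if k is k'.+1 then
    exists2 r, forall i, mpow k' (r i) & p = \sum_i tvar i * r i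
  else True.

Arguments mpow : simpl never.

Lemma mpowSP k p : mpow k.+1 p ->
  exists2 r, forall i, mpow k (r i) & p = \sum_i tvar i * r i.
Proof. by []. Qed.

Lemma mpow_ideal k : is_ideal (mpow k).
Proof.
elim: k => [|k IHk]; first by split.
split=> [|p q /mpowSP[r rk ->] /mpowSP[s sk ->]|c p /mpowSP[r rk ->]].
- exists (fun=> 0) => [i|]; first exact: (ideal0 IHk).
  by rewrite big1 // => i _; rewrite mulr0.
- exists (fun i => r i + s i) => [i|]; first exact: (idealD IHk (rk i) (sk i)).
  by rewrite -big_split; apply: eq_bigr => i _; rewrite mulrDr.
- exists (fun i => c * r i) => [i|]; first exact: (idealM _ IHk (rk i)).
  by rewrite mulr_sumr; apply: eq_bigr => i _; rewrite mulrCA.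
Qed.

Lemma mpowMt k i p : mpow k p -> mpow k.+1 (tvar i * p).
Proof.
move=> pk; exists (fun j => if j == i then p else 0) => [j|].
  by case: ifP => // _; apply: ideal0; apply: mpow_ideal.
rewrite (bigD1 i) //= eqxx big1 ?addr0 // => j /negPf ->.
by rewrite mulr0.
Qed.

Lemma mpowM j k p q : mpow j p -> mpow k q -> mpow (j + k) (p * q).
Proof.
elim: j p => [|j IHj] p; first by move=> _ qk; apply: idealM qk; apply: mpow_ideal.
case/mpowSP=> r rj -> qk; rewrite mulr_suml; apply: (ideal_sum (mpow_ideal _)) => i _.
by rewrite -mulrA; exact: (mpowMt _ (IHj _ (rj i) qk)).
Qed.

(** Every polynomial is congruent to its value at [x] modulo the ideal of the [tvar i], because this
    property holds for the variables and passes to sums and products. *)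
Lemma mpow1P p : mpow 1 p <-> p.@[x] = 0.
Proof.
split=> [[r _ ->]|px].
  by rewrite raddf_sum big1 //= => i _; rewrite mevalM meval_tvar mul0r.
suff: mpow 1 (p - p.@[x]%:MP) by rewrite px mpolyC0 subr0.
have iM := mpow_ideal 1.
have mM (q r : mxp) : mpow 1 (q - q.@[x]%:MP) -> mpow 1 (r - r.@[x]%:MP) ->
    mpow 1 (q * r - (q * r).@[x]%:MP).
  move=> q1 r1; rewrite mevalM mpolyCM.
  have -> : q * r - q.@[x]%:MP * r.@[x]%:MP =
    r * (q - q.@[x]%:MP) + q.@[x]%:MP * (r - r.@[x]%:MP).
    by rewrite !mulrBr [r * q]mulrC [r * _]mulrC addrA subrK.
  by apply: idealD => //; apply: idealM.
elim/mpolyind: p {px} => [|c m p _ _ IHp].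
  by rewrite meval0 mpolyC0 subr0; apply: ideal0.
rewrite mevalD mpolyCD opprD addrACA; apply: idealD => //.
rewrite mevalZ mpolyCM -mul_mpolyC -mulrBr; apply: idealM => //.
rewrite mpolyXE_id.
elim/big_ind: _ => [|q r q1 r1|i _]; last 1 first.
- elim: (m i) => [|k IHk].
    by rewrite expr0 meval1 mpolyC1 subrr; apply: ideal0.
  rewrite exprS; apply: mM => //; rewrite mevalXU -/(tvar i) -[tvar i]mulr1.
  exact: (@mpowMt 0).
- by rewrite meval1 mpolyC1 subrr; apply: ideal0.
- exact: mM.
Qed.

Lemma vfield_mpow k a p : mpow k.+1 p -> mpow k (vfield a p).
Proof.
elim: k p => [|k IHk] p; first by [].
case/mpowSP=> r rk ->; rewrite vfield_sum.
apply: (ideal_sum (mpow_ideal k.+1)) => i _; rewrite vfieldM.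
apply: (idealD (mpow_ideal k.+1)); first exact: (idealM _ (mpow_ideal k.+1) (rk i)).
exact: (mpowMt _ (IHk _ (rk i))).
Qed.

(** Euler's identity for order of vanishing at [x]: by Leibniz, each factor [tvar i] contributes 1
    to the eigenvalue. *)
Lemma euler_mpow k p : mpow k p -> mpow k.+1 (vfield tvar p - k%:R * p).
Proof.
elim: k p => [|k IHk] p.
  rewrite mul0r subr0 => _; rewrite /vfield.
  by apply: (ideal_sum (mpow_ideal 1)) => i _; apply: (@mpowMt 0).
case/mpowSP=> r rk ->; rewrite vfield_sum mulr_sumr -sumrB.
apply: (ideal_sum (mpow_ideal k.+2)) => i _.
rewrite vfieldM vfield_tvar -natr1.
have -> : tvar i * r i + tvar i * vfield tvar (r i) -
    (k%:R + 1) * (tvar i * r i) = tvar i * (vfield tvar (r i) - k%:R * r i) by ring.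
exact: (mpowMt _ (IHk _ (rk i))).
Qed.

(** Pigeonhole: a product of more than [N * n] factors chosen among [N] coordinates contains the
    [n]-th power of one of them. *)
Lemma mpow_sub_ideal I n : is_ideal I -> (forall i, I (tvar i ^+ n)) ->
  forall p, mpow (N * n).+1 p -> I p.
Proof.
move=> iI tI.
(* [e] records the coordinate factors already extracted from [p], and [k] the order still to be
   unfolded; their total is preserved. *)
suff H k (e : 'I_N -> nat) p : (N * n < k + \sum_i e i)%N -> mpow k p ->
    I (\prod_i tvar i ^+ e i * p).
  move=> p pk; have := H _ (fun=> 0%N) p _ pk.
  rewrite big1_eq addn0 ltnS leqnn => /(_ isT).
  by rewrite big1 ?mul1r.
elim: k e p => [|k IHk] e p.
  rewrite add0n => ltNe _; apply: ideal_mulr => //.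
  have [i ei] : exists i, (n <= e i)%N.
    apply/existsP; apply: contraLR ltNe => /existsPn ltn; rewrite -leqNgt.
    rewrite -[N in (N * n)%N]card_ord -sum_nat_const; apply: leq_sum => i _.
    by have:= ltn i; rewrite -ltnNge => /ltnW.
  rewrite (bigD1 i) //=; apply: ideal_mulr => //.
  by rewrite -(subnK ei) exprD; apply: idealM.
move=> lt /mpowSP[r rk ->]; rewrite mulr_sumr; apply: ideal_sum => // i _.
have -> : \prod_j tvar j ^+ e j * (tvar i * r i) =
    \prod_j tvar j ^+ (e j + (j == i))%N * r i.
  rewrite mulrA; congr (_ * _); under [RHS]eq_bigr do rewrite exprD.
  rewrite big_split /=; congr (_ * _); rewrite (bigD1 i) //= eqxx expr1.
  by rewrite big1 ?mulr1 // => j /negPf ->.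
apply: IHk (rk i); rewrite big_split /= addnA -[X in (_ < _ + X)%N]big_mkcond /=.
by rewrite sum1_card card1 addn1 -addSn.
Qed.

Lemma krull I p : is_ideal I ->
  (forall k, ideal_sum_set I (mpow k) p) ->
  exists2 q, q.@[x] != 0 & I (q * p).
Proof.
move=> iI Ip.
(* [M] is I + m p. Once [p] lies in it, (1 - s) p is in [I] with [s] zero at [x], so 1 - s is the
   required multiplier. *)
pose M : set mxp := fun u => exists2 s, s.@[x] = 0 & I (u - s * p).
suff [s s0 Is] : M p.
  exists (1 - s); first by rewrite mevalB meval1 s0 subr0 oner_neq0.
  by rewrite mulrBl mul1r.
have iM : is_ideal M.
  split=> [|u v [s s0 Is] [t t0 It]|c u [s s0 Is]].
  - by exists 0; rewrite ?meval0 // mul0r subrr; apply: ideal0.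
  - exists (s + t); first by rewrite mevalD s0 t0 addr0.
    by rewrite mulrDl opprD addrACA; apply: idealD.
  - exists (c * s); first by rewrite mevalM s0 mulr0.
    by rewrite -mulrA -mulrBr; apply: idealM.
have IM u : I u -> M u by exists 0; rewrite ?meval0 // mul0r subr0.
pose Q (J : set mxp) := [/\ is_ideal J, forall u, M u -> J u &
  forall u c, J u -> I (u - c * p) -> M u].
(* Adjoining high powers of the coordinates one at a time keeps the trace of
   the ideal on I + (p) equal to M: if u = v + b t^n lies in that trace, then
   t u is in M, so b t^(n+1) is in J, hence b t^n already is. *)
have [J [n [QJ Jt]]] : exists J n, Q J /\ forall t, t \in codom tvar -> J (t ^+ n).
  have : forall t, t \in codom tvar -> t.@[x] = 0.
    by move=> _ /codomP[i ->]; apply: meval_tvar.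
  elim: (codom tvar) => [|t l IHl] lx; first by exists M, 0%N; split; [split|].
  have [s sl|J [n [[iJ MJ JM] Jl]]] := IHl; first by apply: lx; rewrite inE sl orbT.
  have [k kP] := noetherian_colon t (@mpoly_noetherian K N) iJ.
  pose J' := ideal_sum_set J (fun u => exists b, u = b * t ^+ k).
  have it : is_ideal (fun u => exists b, u = b * t ^+ k).
    split=> [|_ _ [b ->] [c ->]|c _ [b ->]].
    - by exists 0; rewrite mul0r.
    - by exists (b + c); rewrite mulrDl.
    - by exists (c * b); rewrite mulrA.
  have iJ' : is_ideal J' by apply: ideal_sum_ideal.
  exists J', (n + k)%N; split.
    split=> // [u /MJ|u c]; first exact: ideal_sum_l.
    case=> v Jv [b ub] Iu; apply: (JM u c) => //.
    rewrite -(subrK v u) ub; apply: idealD => //; apply: (kP b k.+1).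
    have -> : b * t ^+ k.+1 = t * u - t * v.
      by rewrite -mulrBr ub exprS mulrCA.
    apply: idealB => //; last exact: idealM.
    apply: MJ; exists (t * c); first by rewrite mevalM lx ?mul0r ?mem_head.
    by rewrite -mulrA -mulrBr; apply: idealM.
  move=> s; rewrite inE exprD => /predU1P[->|/Jl Js].
    by apply: idealM => //; apply: ideal_sum_r => //; exists 1; rewrite mul1r.
  by apply: ideal_mulr => //; apply: ideal_sum_l.
(* [J] now contains a power of every coordinate, hence a power of m. As [p] is in [I] plus that
   power, it lies in [J], and the trace condition puts it in [M]. *)
have [iJ MJ JM] := QJ; apply: (JM p 1); last by rewrite mul1r subrr; apply: ideal0.
have [f If pf] := Ip (N * n).+1.
rewrite -(subrK f p); apply: idealD => //; last exact/MJ/IM.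
by apply: mpow_sub_ideal pf => // i; apply/Jt/codom_f.
Qed.

(* J should be thought of as the ideal of an orbit of the fields in V through x,
   and P as a projection onto the span of these fields at x. The Euler field at
   x acts on m^k / m^(k+1) as multiplication by k, and modulo I + m^2 it is a
   combination of fields in V. *)
Lemma formal_density (I J : set mxp) (V : set ('I_N -> mxp)) (P : 'I_N -> 'I_N -> K) :
  [pchar K] =i pred0 -> is_ideal I ->
  (forall p, J p -> p.@[x] = 0) ->
  (forall a p, V a -> I p -> I (vfield a p)) ->
  (forall a p, V a -> J p -> J (vfield a p)) ->
  (forall i, exists2 a, V a & forall j, (a j).@[x] = P i j) ->
  (forall j, ideal_sum_set I (mpow 2)
     (\sum_i ((i == j)%:R - P i j)%:MP * tvar i)) ->
  forall p k, J p -> ideal_sum_set I (mpow k) p.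
Proof.
move=> char0 iI Jx VI VJ VP IP p k.
have iS j : is_ideal (ideal_sum_set I (mpow j)).
  by apply: ideal_sum_ideal => //; apply: mpow_ideal.
elim: k p => [|[|k] IHk] p Jp; first exact: ideal_sum_r.
  by apply: ideal_sum_r => //; apply/mpow1P/Jx.
have [f If] := IHk p Jp; set r := p - f => rk.
rewrite -(subrK f p) -/r; apply: idealD (iS _) _ _; last first.
  by apply: ideal_sum_l => //; apply: mpow_ideal.
have IMt j i q : ideal_sum_set I (mpow j) q -> ideal_sum_set I (mpow j.+1) (tvar i * q).
  case=> h Ih qh; exists (tvar i * h); first exact: idealM.
  by rewrite -mulrBr; apply: mpowMt.
have [a aV aP] : exists2 a : 'I_N -> 'I_N -> mxp,
    forall i, V (a i) & forall i j, (a i j).@[x] = P i j.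
  have /choice[a aP] : forall i, exists b, V b /\ forall j, (b j).@[x] = P i j.
    by move=> i; have [b Vb bP] := VP i; exists b.
  by exists a => i; have [] := aP i.
(* Characteristic 0 allows division by [k.+1], the Euler eigenvalue of [r] modulo the next power. *)
suff : ideal_sum_set I (mpow k.+2) (k.+1%:R * r).
  move/(idealM ((k.+1%:R : K)^-1)%:MP (iS _)).
  have k0 : k.+1%:R != 0 :> K.
    by apply/negP => /(natf0_pchar (ltn0Sn k))[q]; rewrite char0.
  by rewrite mulrA -mpolyC_nat -mpolyCM mulVf // mpolyC1 mul1r.
have -> : k.+1%:R * r = vfield tvar r - (vfield tvar r - k.+1%:R * r).
  by rewrite opprB addrC subrK.
apply: idealB (iS _) _ _; last first.
  by apply: ideal_sum_r => //; apply: euler_mpow.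
(* Split the Euler field into a combination of fields in [V] and an error. The first part gains one
   order from [tvar i]; the error has coefficients in I + m^2, which outweighs the one order lost by
   differentiating [r]. *)
have -> : vfield tvar r = \sum_i tvar i * vfield (a i) r +
  \sum_j (tvar j - \sum_i tvar i * a i j) * r^`M(j).
  under [X in _ + X]eq_bigr do rewrite mulrBl mulr_suml.
  rewrite sumrB exchange_big /= addrCA -[LHS]addr0; congr (_ + _).
  apply/esym/eqP; rewrite subr_eq0; apply/eqP/eq_bigr => i _.
  by rewrite mulr_sumr; apply: eq_bigr => j _; rewrite mulrA.
apply: idealD (iS _) _ _; apply: ideal_sum (iS _) _ => i _.
  apply: IMt; have -> : r = p - f by [].
  rewrite vfieldB; apply: idealB (iS _) _ _; first exact/IHk/VJ.
  by apply: ideal_sum_l (mpow_ideal _) _; apply: VI.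
have [h Ih hP] : ideal_sum_set I (mpow 2) (tvar i - \sum_j tvar j * a j i).
  have -> : tvar i - \sum_j tvar j * a j i =
    \sum_j ((j == i)%:R - P j i)%:MP * tvar j -
    \sum_j tvar j * (a j i - (P j i)%:MP).
    rewrite -sumrB; transitivity (\sum_j ((j == i)%:R * tvar j - tvar j * a j i)).
      rewrite sumrB; congr (_ - _).
      rewrite (bigD1 i) //= eqxx mul1r big1 ?addr0 // => j /negPf ->.
      by rewrite mul0r.
    by apply: eq_bigr => j _; rewrite mpolyCB mpolyC_nat; ring.
  apply: idealB (iS _) _ _; first exact: IP.
  apply: ideal_sum_r => //; apply: ideal_sum (mpow_ideal 2) _ => j _.
  by apply: mpowMt; apply/mpow1P; rewrite mevalB mevalC aP subrr.
exists (h * r^`M(i)); first exact: ideal_mulr.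
rewrite -mulrBl -[k.+2]/(2 + k)%N; apply: mpowM => //.
have -> : r^`M(i) = vfield (fun j => (j == i)%:R) r.
  rewrite /vfield (bigD1 i) //= eqxx mul1r big1 ?addr0 // => j /negPf ->.
  by rewrite mul0r.
exact: vfield_mpow.
Qed.

End PointIdeal.

(** * Polynomial functions of matrices *)

Lemma mpoly_ring_ind (K : comNzRingType) N (P : {mpoly K[N]} -> Prop) :
  (forall c, P c%:MP) -> (forall i, P 'X_i) ->
  (forall p q, P p -> P q -> P (p + q)) ->
  (forall p q, P p -> P q -> P (p * q)) -> forall p, P p.
Proof.
move=> PC PX PD PM; elim/mpolyind=> [|c m p _ _ IHp].
  by rewrite -mpolyC0; exact: (PC).
apply: (PD) => //; rewrite -mul_mpolyC; apply: (PM); first exact: PC.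
rewrite mpolyXE_id; elim/big_ind: _ => [|p1 p2|i _]; last 1 first.
- elim: (m i) => [|k IHk]; first by rewrite expr0 -mpolyC1; exact: (PC).
  by rewrite exprS; apply: (PM).
- by rewrite -mpolyC1; exact: (PC).
- exact: PM.
Qed.

Section MatrixPolynomials.
Variables (K : fieldType) (m n : nat).
Local Notation gl := 'M[K]_(m + n).
Local Notation N := ((m + n) * (m + n))%N.
Local Notation mxpol := {mpoly K[N]}.
Implicit Types (p q : mxpol) (A B X Y h : gl).

Definition pt A : 'I_N -> K := fun k => mxvec A 0 k.

Definition mxbasis (k : 'I_N) : gl := vec_mx (delta_mx 0 k).

Lemma mxbasis_sum A : A = \sum_k pt A k *: mxbasis k.
Proof.
rewrite -[LHS]mxvecK [mxvec A]row_sum_delta linear_sum.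
by apply: eq_bigr => k _; rewrite linearZ.
Qed.

Lemma mxevalE p A : mxeval p A = p.@[pt A]. Proof. by []. Qed.

Lemma mxevalD p q A : mxeval (p + q) A = mxeval p A + mxeval q A.
Proof. exact: mevalD. Qed.

Lemma mxevalM p q A : mxeval (p * q) A = mxeval p A * mxeval q A.
Proof. exact: mevalM. Qed.

Lemma mxevalXn p k A : mxeval (p ^+ k) A = mxeval p A ^+ k.
Proof. exact: rmorphXn. Qed.

Lemma mxevalC c A : mxeval c%:MP A = c.
Proof. exact: mevalC. Qed.

Lemma mxevalXU k A : mxeval 'X_k A = pt A k.
Proof. exact: mevalXU. Qed.

Lemma mxdiffE p A X : mxdiff p A X = (vfield (fun k => (pt X k)%:MP) p).@[pt A].
Proof.
by rewrite /mxdiff /vfield raddf_sum; apply: eq_bigr => k _ /=; rewrite mevalM mevalC.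
Qed.

Lemma mxdiff_vfield p A X a : (forall k, (a k).@[pt A] = pt X k) ->
  (vfield a p).@[pt A] = mxdiff p A X.
Proof.
move=> aX; rewrite /vfield raddf_sum.
by apply: eq_bigr => k _ /=; rewrite mevalM aX.
Qed.

Lemma mxdiffC c A X : mxdiff c%:MP A X = 0.
Proof. by rewrite mxdiffE vfieldC meval0. Qed.

Lemma mxdiffX k A X : mxdiff 'X_k A X = pt X k.
Proof. by rewrite mxdiffE vfieldX mevalC. Qed.

Lemma mxdiffD p q A X : mxdiff (p + q) A X = mxdiff p A X + mxdiff q A X.
Proof. by rewrite !mxdiffE vfieldD mevalD. Qed.

Lemma mxdiffM p q A X :
  mxdiff (p * q) A X = mxdiff p A X * mxeval q A + mxeval p A * mxdiff q A X.
Proof. by rewrite !mxdiffE vfieldM mevalD !mevalM. Qed.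

Lemma mxdiff_sum (I : finType) (F : I -> mxpol) A X :
  mxdiff (\sum_i F i) A X = \sum_i mxdiff (F i) A X.
Proof.
rewrite mxdiffE vfield_sum raddf_sum; apply: eq_bigr => i _.
by rewrite mxdiffE.
Qed.

Definition lform (l : gl -> K) : mxpol := \sum_k (l (mxbasis k))%:MP * 'X_k.

Lemma mxeval_lform l A : scalar l -> mxeval (lform l) A = l A.
Proof.
move=> hl; have l0 : l 0 = 0.
  have /eqP := hl 1 0 0; rewrite scaler0 addr0 mul1r.
  by rewrite -subr_eq0 opprD addrA subrr sub0r oppr_eq0 => /eqP.
have lD : {morph l : B C / B + C >-> B + C}.
  by move=> B C; have := hl 1 B C; rewrite scale1r mul1r.
rewrite [in RHS](mxbasis_sum A) (big_morph l lD l0) mxevalE raddf_sum.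
apply: eq_bigr => k _ /=; rewrite mevalM mevalC mevalXU mulrC.
by have := hl (pt A k) (mxbasis k) 0; rewrite l0 !addr0.
Qed.

Lemma mxdiff_lform l A X : scalar l -> mxdiff (lform l) A X = l X.
Proof.
move=> hl; rewrite -[RHS](mxeval_lform _ hl) mxdiff_sum mxevalE raddf_sum.
apply: eq_bigr => k _ /=; rewrite mxdiffM mxdiffC mul0r add0r mxdiffX.
by rewrite mxevalE mevalM !mevalC mevalXU.
Qed.

(** The vector field of infinitesimal conjugation by [X], whose value at [A] is [X, A]. *)
Definition adfield X : 'I_N -> mxpol := fun k =>
  lform (fun A => pt (X *m A - A *m X) k).

Lemma adfield_scalar X k : scalar (fun A => pt (X *m A - A *m X) k).
Proof.
move=> a A B; rewrite /pt mulmxDr mulmxDl -scalemxAl -scalemxAr opprD addrACA.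
by rewrite -scalerBr linearP !mxE.
Qed.

Lemma adfieldE X A k : (adfield X k).@[pt A] = pt (X *m A - A *m X) k.
Proof. by rewrite -mxevalE mxeval_lform //; apply: adfield_scalar. Qed.

(** Conjugation by a fixed [h] is linear, so polynomials pull back to polynomials and the chain rule
    has this simple form. *)
Lemma conj_subst h p : exists q,
  forall A, mxeval q A = mxeval p (h *m A *m invmx h) /\
  forall X, mxdiff q A X = mxdiff p (h *m A *m invmx h) (h *m X *m invmx h).
Proof.
elim/mpoly_ring_ind: p => [c|k|p p' [q qP] [q' q'P]|p p' [q qP] [q' q'P]].
- by exists c%:MP => A; split=> [|X]; rewrite ?mxdiffC ?mxevalC.
- exists (lform (fun A => pt (h *m A *m invmx h) k)) => A.
  have hl : scalar (fun A => pt (h *m A *m invmx h) k).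
    by move=> a B C; rewrite /pt mulmxDr mulmxDl -scalemxAr -scalemxAl linearP !mxE.
  split=> [|X]; first by rewrite mxeval_lform // mxevalXU.
  by rewrite mxdiff_lform // mxdiffX.
- exists (q + q') => A; have [e d] := qP A; have [e' d'] := q'P A.
  by split=> [|X]; rewrite ?mxdiffD ?d ?d' // !mxevalD e e'.
- exists (q * q') => A; have [e d] := qP A; have [e' d'] := q'P A.
  split=> [|X]; rewrite ?mxdiffM ?d ?d' ?e ?e' //.
  by rewrite !mxevalM e e'.
Qed.

Definition gmx : 'M[mxpol]_(m + n) := \matrix_(i, j) 'X_(mxvec_index i j).

Local Notation ev A := (map_mx (meval (pt A))).
Local Notation dv A X := (map_mx (fun p => mxdiff p A X)).

Lemma evE A (P : 'M[mxpol]_(m + n)) i j : mxeval (P i j) A = (ev A P) i j.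
Proof. by rewrite mxE. Qed.

Lemma dvE A X (P : 'M[mxpol]_(m + n)) i j : mxdiff (P i j) A X = (dv A X P) i j.
Proof. by rewrite mxE. Qed.

Lemma ev_gmx A : ev A gmx = A.
Proof. by apply/matrixP=> i j; rewrite !mxE mevalXU /pt mxvecE. Qed.

Lemma dv_gmx A X : dv A X gmx = X.
Proof. by apply/matrixP=> i j; rewrite !mxE mxdiffX /pt mxvecE. Qed.

Lemma dv_mul A X (P Q : 'M[mxpol]_(m + n)) :
  dv A X (P *m Q) = dv A X P *m ev A Q + ev A P *m dv A X Q.
Proof.
apply/matrixP=> i j; rewrite !mxE mxdiff_sum -big_split; apply: eq_bigr => k _.
by rewrite mxdiffM !mxE.
Qed.

Lemma ev_const A (P : gl) : ev A (map_mx (@mpolyC _ _) P) = P.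
Proof. by apply/matrixP=> i j; rewrite !mxE mevalC. Qed.

Lemma dv_const A X (P : gl) : dv A X (map_mx (@mpolyC _ _) P) = 0.
Proof. by apply/matrixP=> i j; rewrite !mxE mxdiffC. Qed.

Lemma ev_adj A : ev A (\adj gmx) = \adj A.
Proof. by rewrite map_mx_adj ev_gmx. Qed.

Lemma mxeval_det A : mxeval (\det gmx) A = \det A.
Proof. by rewrite mxevalE -det_map_mx ev_gmx. Qed.

(** Differentiate at the identity the relation between a matrix, its adjugate and its
    determinant. *)
Lemma dv1_adj X : dv 1%:M X (\adj gmx) = (mxdiff (\det gmx) 1%:M X)%:M - X.
Proof.
have := congr1 (dv 1%:M X) (mul_mx_adj gmx).
have -> : dv 1%:M X ((\det gmx)%:M : 'M_(m + n)) =
    (mxdiff (\det gmx) 1%:M X)%:M.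
  apply/matrixP=> i j; rewrite !mxE; case: eqP => _; rewrite ?mulr1n // !mulr0n.
  by rewrite -mpolyC0 mxdiffC.
rewrite dv_mul dv_gmx ev_adj ev_gmx.
have -> : \adj (1%:M : gl) = 1%:M.
  by rewrite -[LHS]mul1mx mul_mx_adj det1.
by rewrite mulmx1 mul1mx => <-; rewrite [RHS]addrC addKr.
Qed.

(* The function h |-> p (h Y h^-1) becomes polynomial after multiplication by
   a power of the determinant. *)
Lemma conj_homogenize Y X p : exists d q,
  (forall h, h \in unitmx ->
     mxeval q h = \det h ^+ d * mxeval p (h *m Y *m invmx h)) /\
  mxdiff q 1%:M X = d%:R * mxdiff (\det gmx) 1%:M X * mxeval p Y
                    + mxdiff p Y (X *m Y - Y *m X).
Proof.
have det1X d : mxdiff (\det gmx ^+ d) 1%:M X = d%:R * mxdiff (\det gmx) 1%:M X.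
  elim: d => [|d IHd]; first by rewrite mul0r expr0 -mpolyC1 mxdiffC.
  rewrite exprS mxdiffM IHd mxevalXn mxeval_det det1 expr1n.
  by rewrite mulr1 mul1r -natr1 mulrDl mul1r addrC.
have det1E d : mxeval (\det gmx ^+ d) 1%:M = 1.
  by rewrite mxevalXn mxeval_det det1 expr1n.
have cj1 : 1%:M *m Y *m invmx 1%:M = Y by rewrite invmx1 mul1mx mulmx1.
elim/mpoly_ring_ind: p => [c|k|p p' [d [q [qE qD]]] [d' [q' [q'E q'D]]]
                              |p p' [d [q [qE qD]]] [d' [q' [q'E q'D]]]].
- exists 0%N, c%:MP; split=> [h hu|]; first by rewrite !mxevalC mul1r.
  by rewrite !mxdiffC !mul0r addr0.
(* The adjugate replaces the inverse at the cost of one factor of the determinant, hence exponent 1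
   for a coordinate. *)
- exists 1%N, (mxvec (gmx *m map_mx (@mpolyC _ _) Y *m \adj gmx) 0 k).
  case/mxvec_indexP: k => i j; rewrite mxvecE; split=> [h hu|].
    rewrite evE !map_mxM ev_gmx ev_const ev_adj mxevalXU /pt mxvecE.
    rewrite expr1 /invmx hu -scalemxAr [in RHS]mxE mulrA divff ?mul1r //.
    by rewrite -unitfE -unitmxE.
  rewrite dvE !dv_mul dv_const map_mxM ev_gmx ev_const dv_gmx ev_adj.
  rewrite dv1_adj mulmx0 addr0 mul1mx.
  have -> : \adj (1%:M : gl) = 1%:M by rewrite -[LHS]mul1mx mul_mx_adj det1.
  rewrite mulmx1 mulmxBr mul_mx_scalar mul1r mxdiffX mxevalXU /pt !mxvecE.
  by rewrite !mxE addrCA.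
- exists (d + d')%N, (q * \det gmx ^+ d' + q' * \det gmx ^+ d).
  split=> [h hu|].
    rewrite !mxevalD !mxevalM !mxevalXn mxeval_det qE // q'E //.
    by rewrite exprD; ring.
  have qe := qE _ (unitmx1 _ _); have q'e := q'E _ (unitmx1 _ _).
  rewrite det1 expr1n mul1r cj1 in qe; rewrite det1 expr1n mul1r cj1 in q'e.
  rewrite !mxdiffD !mxdiffM !det1X !det1E !mulr1 qD q'D qe q'e.
  rewrite mxevalD natrD.
  ring.
- exists (d + d')%N, (q * q'); split=> [h hu|].
    by rewrite !mxevalM qE // q'E // exprD mulrACA.
  have qe := qE _ (unitmx1 _ _); have q'e := q'E _ (unitmx1 _ _).
  rewrite det1 expr1n mul1r cj1 in qe; rewrite det1 expr1n mul1r cj1 in q'e.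
  rewrite !mxdiffM qD q'D qe q'e mxevalM natrD.
  ring.
Qed.

(** Conjugation by [h] fixes the identity and preserves [G], so pulling back along it preserves the
    vanishing ideal of [G]. *)
Lemma lie_conj (G : set gl) h X : is_subgroup G -> G h ->
  lie_of_group G X -> lie_of_group G (h *m X *m invmx h).
Proof.
case=> GU G1 GM GV Gh lX p pG; have [q qP] := conj_subst h p.
have hu : h \in unitmx by case: (GU _ Gh).
have [_ /(_ X)] := qP 1%:M; rewrite mulmx1 mulmxV // => <-; apply: lX => k Gk.
by have [-> _] := qP k; apply: pG; apply: (GM _ _ _ (GV _ Gh)); exact: GM.
Qed.

(** For [Y] in [S] the function h |-> p (h Y h^-1) is zero on [G]. Its derivative at 1 along [X] is
    the value at [Y] of the field applied to [p], the determinant term dropping out since [p] is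
    zero at [Y]. *)
Lemma adfield_vanishing (G S : set gl) X p : is_subgroup G ->
  (forall h Y, G h -> S Y -> S (h *m Y *m invmx h)) ->
  lie_of_group G X -> vanishing_ideal S p ->
  vanishing_ideal S (vfield (adfield X) p).
Proof.
case=> GU G1 GM GV GS lX pS Y SY.
have [d [q [qE qD]]] := conj_homogenize Y X p.
rewrite mxevalE (mxdiff_vfield _ (X := X *m Y - Y *m X)); last exact: adfieldE.
move: qD; rewrite pS // mulr0 add0r => <-; apply: lX => h Gh.
by rewrite qE ?(pS _ (GS _ _ Gh SY)) ?mulr0 //; case: (GU _ Gh).
Qed.

Lemma vanishing_is_ideal (S : set gl) : is_ideal (vanishing_ideal S).
Proof.
split=> [A _|p q pS qS A SA|c p pS A SA]; rewrite mxevalE.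
- by rewrite meval0.
- by rewrite mevalD -!mxevalE pS ?qS ?addr0.
- by rewrite mevalM -!mxevalE pS ?mulr0.
Qed.
End MatrixPolynomials.

(** * Tangent space of a conjugation orbit *)

Section OrbitEquations.
Variables (K : fieldType) (m n : nat).
Local Notation gl := 'M[K]_(m + n).
Local Notation N := ((m + n) * (m + n))%N.
Local Notation mxpol := {mpoly K[N]}.
Implicit Types (p q : mxpol) (A B X Y h x : gl).

Lemma even_mul A B :
  A \in glpart false -> B \in glpart false -> A *m B \in glpart false.
Proof.
rewrite !mem_glpart => /eqP <- /eqP <-; rewrite /hpart mulmx_block.
by rewrite !(mul0mx, mulmx0, addr0, add0r) block_mxKul block_mxKdr.
Qed.

Lemma even_scalar (c : K) : (c%:M : gl) \in glpart false.
Proof.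
by rewrite mem_glpart /hpart scalar_mx_block block_mxKul block_mxKdr.
Qed.

Lemma even_inv A : A \in unitmx -> A \in glpart false -> invmx A \in glpart false.
Proof.
move=> Au; have := Au; rewrite mem_glpart => + /eqP Ae.
rewrite -{1}Ae /hpart unitmxE det_ublock unitrM => /andP[au du].
have -> : invmx A = block_mx (invmx (ulsubmx A)) 0 0 (invmx (drsubmx A)).
  apply: (can_inj (mulKmx Au)); rewrite mulmxV // -{1}Ae /hpart mulmx_block.
  rewrite !(mul0mx, mulmx0, addr0, add0r) !mulmxV // ?unitmxE //.
  by rewrite -scalar_mx_block.
by rewrite mem_glpart /hpart block_mxKul block_mxKdr.
Qed.

Lemma GLxGL_mul h k : GLxGL h -> GLxGL k -> GLxGL (h *m k).
Proof. by move=> [he hu] [ke ku]; split; [apply: even_mul|rewrite unitmx_mul hu]. Qed.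

Lemma GLxGL_inv h : GLxGL h -> GLxGL (invmx h).
Proof. by move=> [he hu]; split; [apply: even_inv|rewrite unitmx_inv]. Qed.

Lemma invmx_mul h k : h \in unitmx -> k \in unitmx ->
  invmx (h *m k) = invmx k *m invmx h.
Proof.
move=> hu ku; have hku : h *m k \in unitmx by rewrite unitmx_mul hu.
apply: (can_inj (mulKmx hku)); rewrite mulmxV // mulmxA -(mulmxA h).
by rewrite mulmxV // mulmx1 mulmxV.
Qed.

Lemma conj_orbit_trans (G : set gl) x y z : is_subgroup G ->
  conj_orbit G x y -> conj_orbit G y z -> conj_orbit G x z.
Proof.
case=> GU _ GM _ [h Gh <-] [k Gk <-]; exists (k *m h); first exact: GM.
have [[_ ku] [_ hu]] := (GU _ Gk, GU _ Gh).
by rewrite invmx_mul // !mulmxA.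
Qed.

Lemma conj_orbit_sym (G : set gl) x y : is_subgroup G ->
  conj_orbit G x y -> conj_orbit G y x.
Proof.
case=> GU _ _ GV [h Gh <-]; exists (invmx h); first exact: GV.
have hu : h \in unitmx by case: (GU _ Gh).
by rewrite invmxK -!mulmxA mulVmx // mulmx1 mulKmx.
Qed.

Lemma GLxGL_subgroup : is_subgroup (@GLxGL K m n).
Proof.
split=> //; last exact: GLxGL_inv; last exact: GLxGL_mul.
by split; rewrite ?unitmx1 ?even_scalar.
Qed.

(** The differential at 1 of the orbit map h |-> h x h^-1; images of subspaces under it are tangent
    spaces of orbits at [x]. *)
Definition adm x : 'End(gl) := (linfun (mulmxr x) - linfun (mulmx x))%R.

Lemma admE x h : adm x h = h *m x - x *m h.
Proof. by rewrite add_lfunE opp_lfunE !lfunE. Qed.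

Lemma lformD (l1 l2 : gl -> K) :
  lform (fun A => l1 A + l2 A) = lform l1 + lform l2.
Proof.
by rewrite /lform -big_split; apply: eq_bigr => k _; rewrite mpolyCD mulrDl.
Qed.

Definition tform x (l : gl -> K) : mxpol := lform l - (l x)%:MP.

Lemma mxeval_tform x l A : scalar l -> mxeval (tform x l) A = l A - l x.
Proof. by move=> hl; rewrite mxevalE mevalB mevalC -mxevalE mxeval_lform. Qed.

(* On the orbit of x, each h |-> h x - y h has rank at most that of the map at
   y = x. The minor bordering a nonsingular maximal minor at x by the form l
   (as a row) and by h = 1 (as a column) therefore vanishes on the orbit, and
   its linear part at x is -l. *)
Lemma orbit_tangent_form x (l : gl -> K) : scalar l ->
  (forall h, h \in glpart false -> l (h *m x - x *m h) = 0) ->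
  ideal_sum_set (vanishing_ideal (conj_orbit GLxGL x)) (mpow (pt x) 2) (tform x l).
Proof.
move=> hl lx.
pose U := (adm x @: glpart false)%VS; pose r := \dim U; pose u := vbasis U.
have /choice[k kP] : forall a : 'I_r, exists k, k \in glpart false /\ adm x k = u`_a.
  move=> a; have : u`_a \in U by apply: vbasis_mem; rewrite mem_nth ?size_tuple.
  by case/memv_imgP=> h he hE; exists h.
(* Index 0 is the border: [l] among the rows, h = 1 among the columns. The other indices run over a
   basis of [U], by coordinate forms and by preimages respectively. *)
pose lam (i : 'I_r.+1) : gl -> K := if unlift ord0 i is Some a then coord u a else l.
pose hh (i : 'I_r.+1) : gl := if unlift ord0 i is Some a then k a else 1%:M.
have lam_scalar i : scalar (lam i).
  by rewrite /lam; case: unlift => [a|] //; apply: linearP.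
have lamM i B : scalar (fun A => lam i (A *m B)).
  by move=> a A A'; rewrite mulmxDl -scalemxAl lam_scalar.
have lamB i A B : lam i (A - B) = lam i A - lam i B.
  by rewrite addrC -scaleN1r lam_scalar mulN1r addrC.
have hhe i : hh i \in glpart false.
  by rewrite /hh; case: unlift => [a|]; [case: (kP a)|apply: even_scalar].
pose M : 'M[mxpol]_r.+1 :=
  \matrix_(i, j) ((lam i (hh j *m x))%:MP - lform (fun A => lam i (A *m hh j))).
have ME A : map_mx (meval (pt A)) M =
    \matrix_(i, j) lam i (hh j *m x - A *m hh j).
  by apply/matrixP=> i j; rewrite !mxE mevalB mevalC -mxevalE mxeval_lform //.
have detM0 : vanishing_ideal (conj_orbit GLxGL x) (\det M).
  move=> _ [c [ce cu] <-]; rewrite mxevalE -det_map_mx ME.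
  set A := c *m x *m invmx c.
  pose w j := adm x (invmx c *m hh j).
  have wU j : w j \in U by apply: memv_img; apply: even_mul (hhe j); apply: even_inv.
  (* At A = c x c^-1 every column vector is [c] times an element of [U], so the matrix of size
     [r.+1] factors through dimension [r]. *)
  have -> : \matrix_(i, j) lam i (hh j *m x - A *m hh j) =
      (\matrix_(i < r.+1, a < r) lam i (c *m u`_a)) *m
      (\matrix_(a < r, j < r.+1) coord u a (w j)).
    apply/matrixP=> i j; rewrite !mxE.
    have -> : hh j *m x - A *m hh j = c *m w j.
      by rewrite /w admE mulmxBr !mulmxA mulmxV // mul1mx.
    rewrite {1}(coord_vbasis (wU j)) mulmx_sumr.
    have l0 : lam i 0 = 0 by rewrite -(subrr 0) lamB subrr.
    have lD : {morph lam i : B C / B + C >-> B + C}.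
      by move=> B C; have := lam_scalar i 1 B C; rewrite scale1r mul1r.
    rewrite (big_morph (lam i) lD l0); apply: eq_bigr => a _; rewrite !mxE mulrC.
    have := lam_scalar i (coord u a (w j)) (c *m u`_a) 0.
    by rewrite l0 !addr0 scalemxAr.
  set P := \matrix_(i < r.+1, a < r) _; set Q := \matrix_(a < r, j < r.+1) _.
  apply/eqP; apply: contraT; rewrite -unitfE -unitmxE => PQu.
  by have := mulmx_max_rank P Q; rewrite mxrank_unit // ltnn.
have M0x j : mxeval (M ord0 j) x = 0.
  have := congr1 (fun P : 'M_r.+1 => P ord0 j) (ME x).
  by rewrite !mxE mxevalE => ->; rewrite /lam unlift_none lx.
(* At [x] the unbordered minor is the identity; any other minor along row 0 keeps the column of h =
   1, which is zero there. *)
have cofx j : mxeval (cofactor M ord0 j) x = (j == ord0)%:R.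
  rewrite mxevalE -cofactor_map_mx ME /cofactor.
  have [-> {j}|j0] := eqVneq j ord0.
    rewrite addn0 expr0 mul1r.
    suff -> : row' ord0 (col' ord0 (\matrix_(i, j) lam i (hh j *m x - x *m hh j)))
      = 1%:M by rewrite det1.
    apply/matrixP=> a b; rewrite !mxE /lam /hh !liftK -admE; have [_ ->] := kP b.
    by rewrite (coord_free b a (basis_free (vbasisP U))) eq_sym.
  have [c cj _] := unlift_some j0.
  rewrite (expand_det_col _ c) big1 ?mulr0 // => i _; rewrite !mxE -cj.
  have -> : hh ord0 = 1%:M by rewrite /hh unlift_none.
  by rewrite mul1mx mulmx1 subrr -(subrr 0) lamB subrr mul0r.
have M00 : M ord0 ord0 = - tform x l.
  rewrite mxE /tform /lam /hh unlift_none mul1mx opprB; congr (_ - _).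
  by apply: eq_bigr => b _; rewrite mulmx1.
(* Expand along row 0: the entry [- tform x l] has a cofactor congruent to 1 modulo m, and every
   other term is a product of two functions vanishing at [x]. *)
exists (- \det M); first exact: (idealN (vanishing_is_ideal _)).
have iM := mpow_ideal (pt x) 2.
rewrite opprK (expand_det_row _ ord0) (bigD1 ord0) //= addrA M00.
rewrite mulNr -{1}[tform x l]mulr1 -mulrBr; apply: (idealD iM).
  apply: (@mpowM _ _ _ 1 1); apply/mpow1P.
    by rewrite -mxevalE mxeval_tform // subrr.
  by rewrite mevalB meval1 -mxevalE cofx eqxx subrr.
apply: (ideal_sum iM) => j j0; apply: (@mpowM _ _ _ 1 1); apply/mpow1P.
  by rewrite -mxevalE M0x.
by rewrite -mxevalE cofx (negPf j0).
Qed.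

End OrbitEquations.

(** * Orbits are constructible *)

Section Definability.
Variable K : fieldType.
Implicit Types (e : seq K) (F : seq K -> K) (P Q : seq K -> Prop).

(** [rterm] excludes inverses, as required by the form of quantifier elimination applied in
    [definable_qf]. *)
Definition term_fun F := exists2 t, GRing.rterm t & forall e, GRing.eval e t = F e.

Lemma term_fun_const c : term_fun (fun=> c).
Proof. by exists (GRing.Const c). Qed.

Lemma term_fun_var k : term_fun (fun e => e`_k).
Proof. by exists (GRing.Var K k). Qed.

Lemma term_funD F1 F2 : term_fun F1 -> term_fun F2 -> term_fun (fun e => F1 e + F2 e).
Proof.
move=> [t rt tE] [u ru uE]; exists (GRing.Add t u) => [|e] /=; first by rewrite rt.
by rewrite tE uE.
Qed.

Lemma term_funM F1 F2 : term_fun F1 -> term_fun F2 -> term_fun (fun e => F1 e * F2 e).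
Proof.
move=> [t rt tE] [u ru uE]; exists (GRing.Mul t u) => [|e] /=; first by rewrite rt.
by rewrite tE uE.
Qed.

Lemma eq_term_fun F1 F2 : F1 =1 F2 -> term_fun F1 -> term_fun F2.
Proof. by move=> eqF [t rt tE]; exists t => // e; rewrite tE. Qed.

Lemma term_fun_sum (I : Type) (r : seq I) (F : I -> seq K -> K) :
  (forall i, term_fun (F i)) -> term_fun (fun e => \sum_(i <- r) F i e).
Proof.
move=> FE; elim: r => [|i r IHr].
  by apply: eq_term_fun (term_fun_const 0) => e; rewrite big_nil.
by apply: eq_term_fun (term_funD (FE i) IHr) => e; rewrite big_cons.
Qed.

Lemma term_fun_mpoly N (p : {mpoly K[N]}) d :
  term_fun (fun e => p.@[fun k => e`_(d + k)]).
Proof.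
elim/mpoly_ring_ind: p => [c|k|p q IHp IHq|p q IHp IHq].
- by apply: eq_term_fun (term_fun_const c) => e; rewrite mevalC.
- by apply: eq_term_fun (term_fun_var (d + k)) => e; rewrite mevalXU.
- by apply: eq_term_fun (term_funD IHp IHq) => e; rewrite mevalD.
- by apply: eq_term_fun (term_funM IHp IHq) => e; rewrite mevalM.
Qed.

Lemma term_mpoly N (t : GRing.term K) : GRing.rterm t ->
  exists p : {mpoly K[N]}, forall e, size e = N ->
    GRing.eval e t = p.@[fun k => e`_k].
Proof.
elim: t => [k|c|k|t IHt u IHu|t IHt|t IHt k|t IHt u IHu|t IHt|t IHt k] //= rt.
- have [ltkN|leNk] := ltnP k N.
    by exists 'X_(Ordinal ltkN) => e _; rewrite mevalXU.
  by exists 0 => e eN; rewrite meval0 nth_default ?eN.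
- by exists c%:MP => e _; rewrite mevalC.
- by exists k%:R%:MP => e _; rewrite mevalC.
- case/andP: rt => /IHt[p pE] /IHu[q qE]; exists (p + q) => e eN.
  by rewrite mevalD pE ?qE.
- by have [p pE] := IHt rt; exists (- p) => e eN; rewrite mevalN pE.
- by have [p pE] := IHt rt; exists (p *+ k) => e eN; rewrite mevalMn pE.
- case/andP: rt => /IHt[p pE] /IHu[q qE]; exists (p * q) => e eN.
  by rewrite mevalM pE ?qE.
- by have [p pE] := IHt rt; exists (p ^+ k) => e eN; rewrite rmorphXn /= pE.
Qed.

Definition definable P :=
  exists2 f : GRing.formula K, GRing.rformula f & forall e, GRing.holds e f <-> P e.

Lemma definable_eq0 F : term_fun F -> definable (fun e => F e = 0).
Proof.
move=> [t rt tE]; exists (GRing.Equal t (GRing.Const 0)) => [|e] /=.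
  by rewrite rt.
by rewrite tE.
Qed.

Lemma definable_not P : definable P -> definable (fun e => ~ P e).
Proof. by move=> [f rf fP]; exists (GRing.Not f) => // e /=; rewrite fP. Qed.

Lemma definable_and P Q : definable P -> definable Q -> definable (fun e => P e /\ Q e).
Proof.
move=> [f rf fP] [h rh hQ]; exists (GRing.And f h) => [|e] /=; first by rewrite rf.
by rewrite fP hQ.
Qed.

Lemma definable_all (T : eqType) (s : seq T) (P : T -> seq K -> Prop) :
  (forall t, definable (P t)) -> definable (fun e => forall t, t \in s -> P t e).
Proof.
move=> dP; elim: s => [|t s [f rf fP]]; first by exists (GRing.Bool true).
have [h rh hP] := dP t; exists (GRing.And h f) => [|e] /=; first by rewrite rh.
rewrite hP fP; split=> [[Pt Ps] u|Ps]; first by rewrite inE => /predU1P[->|/Ps].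
by split=> [|u us]; apply: Ps; rewrite inE ?eqxx ?us ?orbT.
Qed.

Lemma definable_exists P (I : seq nat) : definable P ->
  definable (fun e => exists2 e', forall k, k \notin I -> e'`_k = e`_k & P e').
Proof.
move=> [f rf fP]; exists (foldr (GRing.Exists (R := K)) f I); first by elim: I.
move=> e; rewrite -GRing.foldExistsP; split=> -[e' ee' e'P]; exists e' => //.
- by move=> k kI; rewrite ee'.
- by apply/fP.
- by move=> k kI; rewrite ee'.
- by apply/fP.
Qed.

End Definability.

Lemma definable_qf (K : closedFieldType) (P : seq K -> Prop) : definable P ->
  exists2 f : GRing.formula K, GRing.qf_form f && GRing.rformula f &
    forall e, GRing.qf_eval e f <-> P e.
Proof.
move=> [f rf fP]; exists (GRing.quantifier_elim (@ClosedFieldQE.ex_elim K) f).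
  exact: GRing.quantifier_elim_wf (@ClosedFieldQE.wf_ex_elim K) _ rf.
move=> e; rewrite -fP; apply: (iff_sym (rwP _)).
exact: (GRing.quantifier_elim_rformP (@ClosedFieldQE.wf_ex_elim K)
  (ClosedFieldQE.holds_ex_elim (@GRing.solve_monicpoly K)) e rf).
Qed.

(** * Orbits as definable sets, and generic constancy of quantifier-free conditions *)

Section Chevalley.
Variables (K : fieldType) (m n : nat).
Local Notation gl := 'M[K]_(m + n).
Local Notation N := ((m + n) * (m + n))%N.
Local Notation mxpol := {mpoly K[N]}.
Implicit Types (p q : mxpol) (A B X Y h x : gl) (e : seq K).

Definition mx_of_seq d e : gl := vec_mx (\row_k e`_(d + k)).

Definition seq_of_mx A : seq K := mkseq (fun k => oapp (pt A) 0 (insub k)) N.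

Lemma pt_mx_of_seq d e k : pt (mx_of_seq d e) k = e`_(d + k).
Proof. by rewrite /pt vec_mxK mxE. Qed.

Lemma nth_seq_of_mx A (k : 'I_N) : (seq_of_mx A)`_k = pt A k.
Proof. by rewrite nth_mkseq // valK. Qed.

Lemma pt_inj A B : pt A =1 pt B -> A = B.
Proof.
move=> AB; apply: (can_inj (@mxvecK _ _ _)); apply/rowP => k; exact: AB.
Qed.

Lemma seq_of_mxK A : mx_of_seq 0 (seq_of_mx A) = A.
Proof. by apply: pt_inj => k; rewrite pt_mx_of_seq nth_seq_of_mx. Qed.

Lemma mxeval_seq p d e : mxeval p (mx_of_seq d e) = p.@[fun k => e`_(d + k)].
Proof. by apply: meval_eq => k; apply: pt_mx_of_seq. Qed.

Lemma term_fun_mxeval p d : term_fun (fun e => mxeval p (mx_of_seq d e)).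
Proof.
by apply: eq_term_fun (term_fun_mpoly p d) => e; rewrite mxeval_seq.
Qed.

Lemma term_fun_entry d i j : term_fun (fun e => mx_of_seq d e i j).
Proof.
apply: eq_term_fun (term_fun_mxeval ('X_(mxvec_index i j) : mxpol) d) => e.
by rewrite mxevalXU /pt mxvecE.
Qed.

(** Noetherianity leaves finitely many equations, and block-diagonal shape is itself a finite list
    of linear ones, so membership becomes first-order. *)
Lemma closed_subgroup_eqs (G : set gl) : zariski_closed G ->
  exists s : seq mxpol, forall h,
    G h <-> (forall p, p \in s -> mxeval p h = 0) /\ h \in unitmx.
Proof.
case=> S ->; have [s [sS Ss]] := @mpoly_noetherian K N S.
pose c k := lform (fun A : gl => pt (hpart false A - A) k).
have cE k A : mxeval (c k) A = pt (hpart false A - A) k.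
  apply: mxeval_lform => a B C; rewrite /pt hpart_is_linear opprD addrACA.
  by rewrite -scalerBr linearP !mxE.
exists ([seq c k | k <- enum 'I_N] ++ s) => h; split=> [[[he hu] hS]|[hs hu]].
  split=> // p; rewrite mem_cat => /orP[/mapP[k _ ->]|/sS]; last exact: hS.
  by rewrite cE; move: he; rewrite mem_glpart => /eqP ->; rewrite subrr /pt linear0 mxE.
split; [split=> //|].
  rewrite mem_glpart -subr_eq0; apply/eqP/pt_inj => k.
  rewrite -cE [RHS]/pt linear0 mxE; apply: hs; rewrite mem_cat map_f ?mem_enum //.
have iV := vanishing_is_ideal (fun A => A = h).
move=> p /Ss sp; apply: (sp _ iV) (erefl h) => q qs _ ->.
by apply: hs; rewrite mem_cat qs orbT.
Qed.

Lemma definable_orbit (G : set gl) x : is_closed_subgroup G ->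
  definable (fun e => conj_orbit G x (mx_of_seq 0 e)).
Proof.
case=> [[GU _ _ _] /closed_subgroup_eqs[s sG]].
(* Variables below [N] hold the point Y, the next [N] hold the conjugating matrix h. The relation Y
   = h x h^-1 is written h x = Y h to avoid the inverse. *)
pose P e := [/\ forall p, p \in s -> mxeval p (mx_of_seq N e) = 0,
  ~ mxeval (\det (gmx K m n)) (mx_of_seq N e) = 0 &
  forall ij, ij \in enum (({: 'I_(m + n)} * {: 'I_(m + n)})%type : finType) ->
    (mx_of_seq N e *m x + (-1) *: (mx_of_seq 0 e *m mx_of_seq N e)) ij.1 ij.2 = 0].
have [f rf fP] : definable P.
  have d1 : definable (fun e => forall p, p \in s -> mxeval p (mx_of_seq N e) = 0).
    by apply: definable_all => p; apply/definable_eq0/term_fun_mxeval.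
  have d2 := definable_not (definable_eq0 (term_fun_mxeval (\det (gmx K m n)) N)).
  have d3 : definable (fun e => forall ij,
      ij \in enum (({: 'I_(m + n)} * {: 'I_(m + n)})%type : finType) ->
      (mx_of_seq N e *m x + (-1) *: (mx_of_seq 0 e *m mx_of_seq N e)) ij.1 ij.2 = 0).
    apply: definable_all => -[i j] /=; apply: definable_eq0.
    apply: (@eq_term_fun _ (fun e => \sum_k mx_of_seq N e i k * x k j +
      (-1) * \sum_k mx_of_seq 0 e i k * mx_of_seq N e k j)).
      by move=> e; rewrite !mxE.
    apply: term_funD.
      apply: term_fun_sum => k; apply: term_funM; last exact: term_fun_const.
      exact: term_fun_entry.
    apply: term_funM; first exact: term_fun_const.
    by apply: term_fun_sum => k; apply: term_funM; apply: term_fun_entry.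
  have [f rf fP] := definable_and (definable_and d1 d2) d3.
  by exists f => // e; rewrite fP; split=> [[[? ?] ?]|[]].
have [f' rf' f'P] := definable_exists (iota N N) (ex_intro2 _ _ f rf fP).
exists f' => // e; rewrite f'P; split=> [[e' ee' [e's e'd e'x]]|[h Gh hx]].
  have -> : mx_of_seq 0 e = mx_of_seq 0 e'.
    apply: pt_inj => k; rewrite !pt_mx_of_seq ee' // mem_iota negb_and -ltnNge.
    by rewrite add0n ltn_ord.
  set h := mx_of_seq N e' in e's e'd e'x *; set Y := mx_of_seq 0 e' in e'x *.
  have hu : h \in unitmx by rewrite unitmxE unitfE -mxeval_det; apply/eqP.
  exists h; first by apply/sG.
  have -> : h *m x = Y *m h; last by rewrite mulmxK.
  apply/eqP; rewrite -subr_eq0 -scaleN1r; apply/eqP/matrixP => i j.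
  by rewrite [RHS]mxE (e'x (i, j)) // mem_enum.
have hu : h \in unitmx by case: (GU _ Gh).
pose Y := mx_of_seq 0 e.
(* The first block is read off through [iota], which pads with 0 when [e] is short, so that [h]
   always starts at position [N]. *)
pose e' := [seq e`_k | k <- iota 0 N] ++ seq_of_mx h ++ drop (N + N) e.
have sz1 : size [seq e`_k | k <- iota 0 N] = N by rewrite size_map size_iota.
have sz2 : size (seq_of_mx h) = N by rewrite size_mkseq.
have e'lo k : (k < N)%N -> e'`_k = e`_k.
  by move=> kN; rewrite nth_cat sz1 kN (nth_map 0%N) ?size_iota // nth_iota.
have e'N : mx_of_seq N e' = h.
  apply: pt_inj => k; rewrite pt_mx_of_seq nth_cat sz1 ltnNge leq_addr /=.
  by rewrite addKn nth_cat sz2 ltn_ord nth_seq_of_mx.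
have e'0 : mx_of_seq 0 e' = Y.
  by apply: pt_inj => k; rewrite !pt_mx_of_seq add0n e'lo.
exists e' => [k|].
  rewrite mem_iota negb_and -ltnNge -leqNgt => /orP[/e'lo //|NNk].
  rewrite nth_cat sz1 ltnNge (leq_trans (leq_addr _ _) NNk) /=.
  rewrite nth_cat sz2 ltnNge leq_subRL ?NNk ?(leq_trans (leq_addr _ _) NNk) //=.
  by rewrite nth_drop -subnDA subnKC.
rewrite /P e'N e'0 mxeval_det; split.
- by have [] := (sG h).1 Gh.
- by apply/eqP; rewrite -unitfE -unitmxE.
- by move=> [i j] _ /=; rewrite scaleN1r -[Y]/(mx_of_seq 0 e) -hx mulmxKV // subrr mxE.
Qed.

(** Every nonempty basic open subset of [S] contains a smaller nonempty one where [b] is constant.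
    Starting from an arbitrary [q0] allows successive refinements, hence Boolean combinations. *)
Definition generically_constant (S : set gl) (b : gl -> bool) : Prop :=
  forall q0, (exists2 Y, S Y & mxeval q0 Y != 0) ->
  exists q, [/\ exists2 Y, S Y & mxeval q Y != 0,
    forall Y, mxeval q Y != 0 -> mxeval q0 Y != 0 &
    forall Y Z, S Y -> S Z -> mxeval q Y != 0 -> mxeval q Z != 0 -> b Y = b Z].

Lemma generically_constant_op (op : bool -> bool -> bool) S b1 b2 :
  generically_constant S b1 -> generically_constant S b2 ->
  generically_constant S (fun Y => op (b1 Y) (b2 Y)).
Proof.
move=> H1 H2 q0 /H1[q1 [/H2[q2 [q2S q21 q2c]] q10 q1c]].
exists q2; split=> // [Y /q21/q10 //|Y Z SY SZ q2Y q2Z].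
by rewrite (q1c Y Z) ?(q2c Y Z) //; apply: q21.
Qed.

(** For an equation, either it fails somewhere on the given open set, which is then shrunk to the
    locus of failure, or it holds there throughout. *)
Lemma qf_eval_generically_constant f (S : set gl) :
  GRing.qf_form f && GRing.rformula f ->
  generically_constant S (fun Y => GRing.qf_eval (seq_of_mx Y) f).
Proof.
elim: f => //=.
- by move=> b _ q0 q0S; exists q0.
- move=> t u /andP[rt ru] q0 [Y0 SY0 q0Y0].
  have [p pE] := term_mpoly N rt; have [q qE] := term_mpoly N ru.
  have pqE Y : (GRing.eval (seq_of_mx Y) t == GRing.eval (seq_of_mx Y) u) =
      (mxeval (p - q) Y == 0).
    rewrite pE ?qE ?size_mkseq // mxevalE mevalB subr_eq0.
    by rewrite !(meval_eq _ (nth_seq_of_mx Y)).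
  have [[Y1 SY1 pqY1]|no] :=
    pselect (exists2 Y, S Y & mxeval ((p - q) * q0) Y != 0).
    exists ((p - q) * q0); split=> [|Y|Y Z SY SZ]; first by exists Y1.
      by rewrite mxevalM mulf_eq0 negb_or => /andP[].
    rewrite !pqE !mxevalM !mulf_eq0 !negb_or.
    by move=> /andP[/negPf -> _] /andP[/negPf ->].
  exists q0; split=> //; first by exists Y0.
  have pq0 Y : S Y -> mxeval q0 Y != 0 -> (mxeval (p - q) Y == 0) = true.
    move=> SY q0Y; apply: contraT => pqY; case: no; exists Y => //.
    by rewrite mxevalM mulf_neq0.
  by move=> Y Z SY SZ q0Y q0Z; rewrite !pqE !pq0.
- move=> f1 IH1 f2 IH2; rewrite andbACA => /andP[/IH1 c1 /IH2 c2].
  exact: (generically_constant_op andb c1 c2).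
- move=> f1 IH1 f2 IH2; rewrite andbACA => /andP[/IH1 c1 /IH2 c2].
  exact: (generically_constant_op orb c1 c2).
- move=> f1 IH1 f2 IH2; rewrite andbACA => /andP[/IH1 c1 /IH2 c2].
  exact: (generically_constant_op implb c1 c2).
- by move=> f IH /IH c; apply: (generically_constant_op (fun b _ => ~~ b) c c).
Qed.

End Chevalley.

(** Both orbits are dense in the same closed set [S], so both meet an open subset on which belonging
    to the orbit of [x] is constant. It is true at the point from the first orbit, hence at the
    point from the second. *)
Lemma orbits_with_same_closure (K : closedFieldType) m n (G : set 'M[K]_(m + n))
    (x y : 'M[K]_(m + n)) : is_closed_subgroup G ->
  (forall p, vanishing_ideal (conj_orbit G x) p <->
             vanishing_ideal (conj_orbit G y) p) ->
  conj_orbit G x y.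
Proof.
move=> cG xy; have [sG _] := cG; have [_ G1 _ _] := sG.
have selfo z : conj_orbit G z z by exists 1%:M => //; rewrite invmx1 mul1mx mulmx1.
have [f wf fP] := definable_qf (definable_orbit x cG).
have fE Y : GRing.qf_eval (seq_of_mx Y) f <-> conj_orbit G x Y by rewrite fP seq_of_mxK.
pose S : set 'M[K]_(m + n) := fun Y => forall p,
  vanishing_ideal (conj_orbit G x) p -> mxeval p Y = 0.
have oxS z : conj_orbit G x z -> S z by move=> xz p; apply.
have oyS z : conj_orbit G y z -> S z by move=> yz p /xy; apply.
have [|q [[Y SY qY] _ qc]] := qf_eval_generically_constant (S := S) wf (q0 := 1).
  by exists x; [apply/oxS/selfo|rewrite mxevalE meval1 oner_neq0].
have meets z : ~ vanishing_ideal (conj_orbit G z) q ->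
    exists2 Z, conj_orbit G z Z & mxeval q Z != 0.
  move=> nv; apply: contrapT => no; apply: nv => Z zZ; apply/eqP/negPn/negP => qZ.
  by apply: no; exists Z.
have qx : ~ vanishing_ideal (conj_orbit G x) q by move=> /SY q0; rewrite q0 eqxx in qY.
have [X xX qX] := meets x qx.
have [Z yZ qZ] : exists2 Z, conj_orbit G y Z & mxeval q Z != 0.
  by apply: meets => /xy.
have /fE xZ : GRing.qf_eval (seq_of_mx Z) f.
  by rewrite -(qc X Z) //; [apply/fE|apply: oxS|apply: oyS].
exact: conj_orbit_trans xZ (conj_orbit_sym sG yZ).
Qed.

(** * Slicing an orbit by a complemented subalgebra *)

Local Arguments hpart : simpl never.

Section Superspaces.
Variables (K : fieldType) (m n : nat).
Local Notation gl := 'M[K]_(m + n).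
Implicit Types (A B X Y h x : gl) (V : {vspace gl}).

Lemma hpartD b A B : hpart b (A + B) = hpart b A + hpart b B.
Proof. exact: linearD. Qed.

Lemma hpart_hpart b b' A :
  hpart b (hpart b' A) = if b == b' then hpart b A else 0.
Proof.
by case: b; case: b'; rewrite /hpart /= ?(block_mxKul, block_mxKur, block_mxKdl,
  block_mxKdr) // -block_mx0.
Qed.

Lemma hpart_sum A : hpart true A + hpart false A = A.
Proof. by rewrite /hpart add_block_mx !addr0 !add0r submxK. Qed.

Lemma hpart_glpart b A : hpart b A \in glpart b.
Proof. by rewrite mem_glpart hpart_hpart eqxx. Qed.

Lemma hpart_mem V b A : is_supersubspace V -> A \in V ->
  hpart b A \in (V :&: glpart b)%VS.
Proof.
move=> sV; rewrite {1}sV => /memv_addP[u]; rewrite memv_cap => /andP[uV].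
rewrite mem_glpart => /eqP u0 [v]; rewrite memv_cap => /andP[vV].
rewrite mem_glpart => /eqP v1 ->; rewrite memv_cap hpart_glpart andbT.
by case: b; rewrite hpartD -u0 -v1 !hpart_hpart ?add0r ?addr0 ?u0 ?v1.
Qed.

Lemma sbracket_even_l X Y : X \in glpart false -> sbracket X Y = X *m Y - Y *m X.
Proof.
rewrite mem_glpart => /eqP X0; have X1 : hpart true X = 0 by rewrite -X0 hpart_hpart.
rewrite /sbracket !big_bool /= X0 X1 !(mul0mx, mulmx0) !scaler0 !subr0 !add0r.
rewrite !expr0 !scale1r addrACA -opprD -mulmxDr -mulmxDl.
by rewrite hpart_sum.
Qed.

Lemma sbracket_even_r X Y : Y \in glpart false -> sbracket X Y = X *m Y - Y *m X.
Proof.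
rewrite mem_glpart => /eqP Y0; have Y1 : hpart true Y = 0 by rewrite -Y0 hpart_hpart.
rewrite /sbracket !big_bool /= Y0 Y1 !(mul0mx, mulmx0) !scaler0 !subr0 !add0r.
rewrite !expr0 !scale1r addrACA -opprD -mulmxDr -mulmxDl.
by rewrite hpart_sum.
Qed.

End Superspaces.

(** * Tangent space and local structure of the slice of an orbit by [g] *)

Section ComplementedSubalgebra.
Variables (K : fieldType) (m n : nat).
Local Notation gl := 'M[K]_(m + n).
Local Notation N := ((m + n) * (m + n))%N.
Local Notation mxpol := {mpoly K[N]}.
Variables (G0 : set gl) (g M : {vspace gl}).
Hypotheses (char0 : [pchar K] =i pred0) (sG0 : is_subgroup G0).
Hypothesis hg : is_lie_subsuperalgebra g.
Hypothesis hLie : forall X, lie_of_group G0 X <-> X \in (g :&: glpart false)%VS.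
Hypothesis hg1 : forall h X, G0 h -> X \in (g :&: glpart true)%VS ->
  h *m X *m invmx h \in (g :&: glpart true)%VS.
Hypotheses (sM : is_supersubspace M) (Mg : (M + g)%VS = fullv).
Hypothesis dMg : directv (M + g).
Hypothesis gM : forall X Y, X \in g -> Y \in M -> sbracket X Y \in M.

Let W x : set gl := fun y => conj_orbit GLxGL x y /\ y \in g.

(** The even part is the Lie algebra of [G0], stable by [lie_conj]; the odd part is stable by
    hypothesis. *)
Lemma conj_mem_subalgebra h X : G0 h -> X \in g -> h *m X *m invmx h \in g.
Proof.
move=> Gh Xg; have [sg _] := hg; rewrite -(hpart_sum X) mulmxDr mulmxDl memvD //.
  by have := hg1 Gh (hpart_mem true sg Xg); rewrite memv_cap => /andP[].
have /hLie X0 := hpart_mem false sg Xg.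
by have /hLie := lie_conj sG0 Gh X0; rewrite memv_cap => /andP[].
Qed.

Lemma conj_mem_slice x h y : G0 h -> W x y -> W x (h *m y *m invmx h).
Proof.
move=> Gh [xy yg]; split; last exact: conj_mem_subalgebra.
apply: conj_orbit_trans (GLxGL_subgroup K m n) xy _; exists h => //.
by case: sG0 => /(_ _ Gh).
Qed.

(** Write h = u + v with even [u] in [M] and even [v] in [g]. Then [u, x] is in [M] by invariance
    and in [g] as [h, x] - [v, x], so it is zero and [h, x] = [v, x]. *)
Lemma tangent_slice x h : x \in g -> h \in glpart false -> adm x h \in g ->
  adm x h \in (adm x @: (g :&: glpart false))%VS.
Proof.
move=> xg he hxg; have [sg bg] := hg.
have /memv_addP[u uM [v vg huv]] : h \in (M + g)%VS by rewrite Mg memvf.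
have /eqP h0 : hpart false h == h by rewrite -mem_glpart.
have u0 := hpart_mem false sM uM; have v0 := hpart_mem false sg vg.
have hE : h = hpart false u + hpart false v by rewrite -hpartD -huv.
move: u0; rewrite memv_cap => /andP[u0M u0e].
have v0g : hpart false v \in g by move: v0; rewrite memv_cap => /andP[].
have v0e := hpart_glpart false v.
have : adm x (hpart false u) \in (M :&: g)%VS.
  rewrite memv_cap; apply/andP; split.
    rewrite admE -opprB memvN -sbracket_even_r //; exact: gM.
  have -> : hpart false u = h - hpart false v by rewrite hE addrK.
  rewrite linearB; apply: memvB => //=; rewrite admE -sbracket_even_l //; exact: bg.
rewrite (directv_addP dMg) memv0 => /eqP u00.
by rewrite hE linearD /= u00 add0r; apply: memv_img.
Qed.

(** Split [l] by means of a projection onto [g] that maps [U] into [U :&: g]. By [tangent_slice] the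
    form [l1] kills [U], so the equations of the big orbit handle it; [l2] kills [g], so its affine
    form is zero on the slice. *)
Lemma slice_tangent_form x (l : gl -> K) : x \in g -> scalar l ->
  (forall X, X \in (adm x @: (g :&: glpart false))%VS -> l X = 0) ->
  ideal_sum_set (vanishing_ideal (W x)) (mpow (pt x) 2) (tform x l).
Proof.
move=> xg hl lT; pose U := (adm x @: glpart false)%VS.
have iI := vanishing_is_ideal (W x).
pose l1 A := l (addv_pi2 U g A); pose l2 A := l A - l1 A.
have l1s : scalar l1 by move=> a A B; rewrite /l1 linearP hl.
have l2s : scalar l2.
  by move=> a A B; rewrite /l2 hl l1s mulrBr opprD addrACA.
have lB A B : l (A - B) = l A - l B.
  by rewrite addrC -scaleN1r hl mulN1r addrC.
have l1U A : A \in U -> l1 A = 0.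
  move=> AU; apply: lT.
  have AUg : A \in (U + g)%VS by apply: (subvP (addvSl U g)).
  have E := addv_pi1_pi2 AUg.
  have p2g : addv_pi2 U g A \in g := memv_pi2 U g A.
  have p2U : addv_pi2 U g A \in U.
    rewrite -[addv_pi2 U g A](addKr (addv_pi1 U g A)) E addrC memvB //.
    exact: memv_pi1.
  by case/memv_imgP: p2U p2g => h he ->; apply: tangent_slice.
have l2g A : A \in g -> l2 A = 0.
  by move=> Ag; rewrite /l2 /l1 addv_pi2_id // subrr.
have -> : tform x l = tform x l1 + tform x l2.
  rewrite /tform addrACA -opprD -lformD -mpolyCD; congr (_ - _%:MP).
    by apply: eq_bigr => k _; rewrite /l2 addrC subrK.
  by rewrite /l2 addrC subrK.
apply: (idealD (ideal_sum_ideal iI (mpow_ideal _ _))).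
  have [h|p pV ph] := @orbit_tangent_form _ _ _ x l1 l1s.
    by move=> he; apply: l1U; rewrite -admE; apply: memv_img.
  by exists p => // y [xy _]; apply: pV.
apply: ideal_sum_l (mpow_ideal _ _) _ => y [_ yg].
by rewrite mxeval_tform // !l2g // subrr.
Qed.

Lemma orbit_locally_dense x : x \in g -> exists2 q, mxeval q x != 0 &
  forall p, vanishing_ideal (conj_orbit G0 x) p ->
  forall y, W x y -> mxeval q y != 0 -> mxeval p y = 0.
Proof.
move=> xg; have [GU G1 GM GV] := sG0.
have iI := vanishing_is_ideal (W x).
pose T := (adm x @: (g :&: glpart false))%VS.
(* The matrix of a projection onto the tangent space [T] of the small orbit: its rows are values at
   [x] of fields in [V], and the coordinates of the complementary projection are linear forms
   killing [T]. *)
pose P (i j : 'I_N) := pt (projv T (mxbasis K i : gl)) j.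
pose V : set ('I_N -> mxpol) := fun a => exists2 X,
  X \in (g :&: glpart false)%VS & a = adfield X.
have W_stable h Y : G0 h -> W x Y -> W x (h *m Y *m invmx h).
  exact: conj_mem_slice.
have O_stable h Y : G0 h -> conj_orbit G0 x Y -> conj_orbit G0 x (h *m Y *m invmx h).
  by move=> Gh xY; apply: conj_orbit_trans xY _ => //; exists h.
have dens p k : vanishing_ideal (conj_orbit G0 x) p ->
    ideal_sum_set (vanishing_ideal (W x)) (mpow (pt x) k) p.
  apply: (@formal_density _ _ (pt x) _ _ V P) => //.
  - move=> q; apply; exists 1%:M => //.
    by rewrite invmx1 mul1mx mulmx1.
  - by move=> _ q [X /hLie lX ->]; apply: adfield_vanishing lX.
  - by move=> _ q [X /hLie lX ->]; apply: adfield_vanishing lX.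
  - move=> i; have /memv_imgP[X Xg0 XE] := memv_proj T (mxbasis K i : gl).
    exists (adfield X); first by exists X.
    by move=> j; rewrite adfieldE /P XE admE.
  - move=> j; pose l A := pt (A - projv T A) j.
    have hl : scalar l.
      move=> a A B; rewrite /l /pt linearP opprD addrACA -scalerBr.
      by rewrite linearP !mxE.
    suff -> : \sum_i ((i == j)%:R - P i j)%:MP * tvar (pt x) i = tform x l.
      apply: slice_tangent_form => // X XT.
      by rewrite /l projv_id // subrr /pt linear0 mxE.
    have lE (i : 'I_N) : l (mxbasis K i : gl) = (i == j)%:R - P i j.
      rewrite /l {1}/pt linearB /= mxE [X in _ + X]mxE; congr (_ - _).
      by rewrite /mxbasis vec_mxK mxE eqxx eq_sym.
    have lx : l x = \sum_(i < N) l (mxbasis K i : gl) * pt x i.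
      rewrite -(mxeval_lform x hl) mxevalE raddf_sum; apply: eq_bigr => i _ /=.
      by rewrite mevalM mevalC mevalXU.
    rewrite /tform lx (big_morph _ (@mpolyCD N K) (@mpolyC0 N K)) /lform -sumrB.
    by apply: eq_bigr => i _; rewrite lE mpolyCM -mulrBr.
have [s [sO Os]] := @mpoly_noetherian K N (vanishing_ideal (conj_orbit G0 x)).
have [q qx qs] : exists2 q, mxeval q x != 0 & forall p, p \in s ->
    forall y, W x y -> mxeval q y != 0 -> mxeval p y = 0.
  elim: s sO {Os} => [|p s IHs] sO.
    by exists 1 => //; rewrite mxevalE meval1 oner_neq0.
  have [p' p's|q qx qs] := IHs; first by apply: sO; rewrite inE p's orbT.
  (* Krull gives one multiplier per generator of the ideal of the small orbit; their product serves
     for the whole ideal. *)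
  have [q' q'x q'p] := krull iI (fun k => dens p k (sO p (mem_head _ _))).
  exists (q' * q) => [|p'' + y Wy]; first by rewrite mxevalM mulf_neq0.
  rewrite mxevalM mulf_eq0 negb_or inE => /predU1P[->|p''s] /andP[q'y qy].
    by have /eqP := q'p y Wy; rewrite mxevalM mulf_eq0 (negPf q'y) => /eqP.
  exact: qs p''s _ Wy qy.
exists q => // p /Os sp y Wy qy.
have iV := vanishing_is_ideal (fun A => A = y).
by apply: (sp _ iV) (erefl y) => p' p's _ ->; apply: qs.
Qed.

End ComplementedSubalgebra.

(** The closure of an orbit is stable under the group, so it contains the whole orbit of each of its
    points. *)
Lemma vanishing_orbit_sub (K : fieldType) m n (G : set 'M[K]_(m + n)) x y p :
  is_subgroup G ->
  (forall q, vanishing_ideal (conj_orbit G x) q -> mxeval q y = 0) ->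
  vanishing_ideal (conj_orbit G x) p -> vanishing_ideal (conj_orbit G y) p.
Proof.
move=> sG xy px _ [k Gk <-]; have [q qP] := conj_subst k p.
have [<- _] := qP y; apply: xy => z xz; have [-> _] := qP z.
by apply: px; apply: conj_orbit_trans xz _ => //; exists k.
Qed.

(** * From open orbits to finitely many orbits *)

Local Open Scope classical_set_scope.

Theorem theorem4p2p1 (R : realType) (m n : nat)
    (G0 : set 'M[R[i]]_(m + n)) (g : {vspace 'M[R[i]]_(m + n)})
    (hG0 : is_closed_subgroup G0)
    (hg : is_lie_subsuperalgebra g)
    (hLie : lie_of_group G0 = [set X | X \in (g :&: glpart false)%VS])
    (hg1 : forall h X, G0 h -> X \in (g :&: glpart true)%VS ->
      h *m X *m invmx h \in (g :&: glpart true)%VS)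
    (hM : exists M : {vspace 'M[R[i]]_(m + n)},
      [/\ is_supersubspace M,
          (M + g)%VS = fullv, directv (M + g)
        & forall X Y, X \in g -> Y \in M -> sbracket X Y \in M])
    (A : 'M[R[i]]_(m + n)) :
  exists s : seq 'M[R[i]]_(m + n),
    conj_orbit GLxGL A `&` [set X | X \in g] =
    \bigcup_(Y in [set` s]) conj_orbit G0 Y.
Proof.
have [M [sM Mg dMg gM]] := hM.
have [sG0 _] := hG0; have [GU G1 _ _] := sG0.
have hLie' X : lie_of_group G0 X <-> X \in (g :&: glpart false)%VS by rewrite hLie.
have sGL := GLxGL_subgroup R[i] m n.
pose W : set 'M[R[i]]_(m + n) := conj_orbit GLxGL A `&` [set X | X \in g].
have W_slice x y : W x -> W y -> conj_orbit GLxGL x y /\ y \in g.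
  move=> [Ax _] [Ay yg]; split=> //.
  exact: conj_orbit_trans (conj_orbit_sym sGL Ax) Ay.
have W_orbit x y : W x -> conj_orbit G0 x y -> W y.
  move=> [Ax xg] [h Gh <-]; split.
    by apply: conj_orbit_trans Ax _ => //; exists h => //; apply: GU.
  exact: (conj_mem_subalgebra sG0 hg hLie' hg1).
have /choice[q qP] : forall x, exists q, W x -> mxeval q x != 0 /\
    forall p, vanishing_ideal (conj_orbit G0 x) p ->
    forall y, W y -> mxeval q y != 0 -> mxeval p y = 0.
  move=> x; have [Wx|nWx] := pselect (W x); last by exists 0.
  have [|q qx qp] := orbit_locally_dense (Num.Theory.pchar_num R[i]) sG0 hg
    hLie' hg1 sM Mg dMg gM (x := x).
    by case: Wx.
  exists q => _; split; first exact: qx.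
  by move=> p px y Wy; exact: (qp p px y (W_slice x y Wx Wy)).
have q_orbit x y : W x -> W y -> mxeval (q x) y != 0 -> conj_orbit G0 x y.
  move=> Wx Wy qxy; have [_ qx] := qP x Wx; have [qyy qy] := qP y Wy.
  have xy p : vanishing_ideal (conj_orbit G0 x) p -> mxeval p y = 0.
    by move=> px; apply: qx.
  apply: orbits_with_same_closure hG0 _ => p; split.
    exact: vanishing_orbit_sub.
  (* [y] is in the closure of the orbit of [x], so the neighbourhood of [y] given by [q y] meets
     that orbit; the meeting point in turn lies in the closure of the orbit of [y]. *)
  have [x' xx' qyx'] : exists2 x', conj_orbit G0 x x' & mxeval (q y) x' != 0.
    apply: contrapT => no; move/eqP: qyy; apply; apply: xy => z xz.
    by apply/eqP/negPn/negP => qz; apply: no; exists z.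
  have yx' r : vanishing_ideal (conj_orbit G0 y) r -> mxeval r x' = 0.
    by move=> yr; apply: qy => //; apply: W_orbit xx'.
  move=> /(vanishing_orbit_sub sG0 yx') px' z xz; apply: px'.
  exact: conj_orbit_trans (conj_orbit_sym sG0 xx') xz.
(* Quasi-compactness: finitely many of the [q x] generate all of them. If these were all zero at a
   point [y] of [W], then so would be [q y]. *)
have [t [tS St]] := @mpoly_noetherian R[i] _ (fun r => exists2 x, W x & r = q x).
have [s sW ts] : exists2 s : seq 'M[R[i]]_(m + n), forall x, x \in s -> W x &
    forall r, r \in t -> exists2 x, x \in s & r = q x.
  elim: t tS {St} => [|r t IHt] tS; first by exists [::].
  have [r' r't|s sW ts] := IHt; first by apply: tS; rewrite inE r't orbT.
  have [x Wx rx] := tS r (mem_head _ _); exists (x :: s) => [y|r'].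
    by rewrite inE => /predU1P[->|/sW].
  rewrite inE => /predU1P[->|/ts[y ys ->]]; first by exists x; rewrite ?mem_head.
  by exists y; rewrite // inE ys orbT.
exists s; rewrite -/W; apply/seteqP; split=> y; last first.
  by case=> x /= /sW Wx; apply: W_orbit.
move=> Wy; apply: contrapT => no.
have [qyy _] := qP y Wy; move/eqP: qyy; apply.
have /St tq : exists2 x, W x & q y = q x by exists y.
apply: (tq _ (vanishing_is_ideal (fun B => B = y))) (erefl y) => r /ts[x xs ->] _ ->.
apply/eqP/negPn/negP => qxy; apply: no; exists x => //.
by apply: q_orbit => //; apply: sW.
Qed.
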